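(* Let $f(x)=\frac1n\sum_{i=1}^n f_i(x)$ on $\mathbb{R}^d$ with each $f_i$ convex and $L$-smooth with a minimizer $x^\star$, and let $x_0$ satisfy $f(x_0)-f(x^\star)\le\Delta_0$. Consider Algorithm R-Acc-SVRG-G (described in the context) run in the IFC mode with accuracy $\epsilon>0$, $\delta_0=L$ and $\beta>1$. Let $q\in(0,1)$, $\delta^\star_{\rm IFC}=\frac{\epsilon^2q^2}{8\Delta_0}$, assume $\epsilon$ is small enough that $\delta^\star_{\rm IFC}\le L$, and let $\ell$ be the first outer iteration with $\delta_\ell\le\delta^\star_{\rm IFC}$. Then (i) at outer iteration $\ell$, the algorithm terminates with probability at least $1-q$; (ii) the total expected oracle complexity of the $\ell+1$ outer loops is $$O\!\left(\Big(n\log\frac{\sqrt{L\Delta_0}}{\epsilon q}+\frac{\sqrt{nL\Delta_0}}{\epsilon q}\Big)\log\frac{\sqrt{L\Delta_0}}{\epsilon q}\right)$$ (with $\beta$ treated as a constant).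
   Context: R-Acc-SVRG-G: input $\epsilon>0$, $\delta_0=L$, $\beta>1$, $x_0$. For outer iterations $t=0,1,2,\dots$: define $f_i^{\delta_t}(x)=f_i(x)+\frac{\delta_t}2\|x-x_0\|^2$, $f^{\delta_t}=\frac1n\sum_i f_i^{\delta_t}$; set $p=\frac1n$, $\alpha$ the unique positive root of $\big(1-\frac{p(\alpha+\delta_t)}{\alpha+L+\delta_t}\big)\big(1+\frac{\delta_t}{\alpha}\big)^2=1$, $\tau_x=\frac{\alpha+\delta_t}{\alpha+L+\delta_t}$, $\tau_z=\frac{\tau_x}{\delta_t}-\frac{\alpha(1-\tau_x)}{\delta_tL}$, $C_{\rm IDC}=L^2+\frac{L\alpha^2p}{L+(1-p)(\alpha+\delta_t)}$, $C_{\rm IFC}=2L+\frac{2L\alpha^2p}{(L+(1-p)(\alpha+\delta_t))\delta_t}$; initialize $z_0=\tilde x_0=x_0$. Inner loop $k=0,1,\dots$: $y_k=\tau_xz_k+(1-\tau_x)\tilde x_k+\tau_z(\delta_t(\tilde x_k-z_k)-\nabla f^{\delta_t}(\tilde x_k))$; $z_{k+1}=\arg\min_x\{\langle\mathcal G^{\delta_t}_k,x\rangle+\frac\alpha2\|x-z_k\|^2+\frac{\delta_t}2\|x-y_k\|^2\}$ with $\mathcal G^{\delta_t}_k=\nabla f^{\delta_t}_{i_k}(y_k)-\nabla f^{\delta_t}_{i_k}(\tilde x_k)+\nabla f^{\delta_t}(\tilde x_k)$, $i_k$ uniform on $\{1,\dots,n\}$; $\tilde x_{k+1}=y_k$ with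 probability $p$, else $\tilde x_k$; if $\|\nabla f(\tilde x_k)\|\le\epsilon$, output $\tilde x_k$ and terminate; in IDC mode, if $(1+\frac{\delta_t}\alpha)^k\ge\sqrt{C_{\rm IDC}}/\delta_t$, break the inner loop; in IFC mode, if $(1+\frac{\delta_t}\alpha)^k\ge\sqrt{C_{\rm IFC}/(2\delta_t)}$, break the inner loop. After the inner loop, set $\delta_{t+1}=\delta_t/\beta$. Oracle complexity is the expected number of component gradient evaluations $\nabla f_i$ (a full gradient costs $n$). *)

(* Defs.v *)
From HB Require Import structures.
From mathcomp Require Import all_boot all_order all_algebra.
From mathcomp Require Import all_classical all_reals all_analysis.
Set Implicit Arguments. Unset Strict Implicit. Unset Printing Implicit Defensive.
Import Order.TTheory GRing.Theory Num.Theory.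
Import numFieldNormedType.Exports.
Local Open Scope ring_scope.
Local Open Scope classical_set_scope.

Section RAccSVRG.
Variable R : realType.

Section Vec.
Variable d : nat.
Local Notation vec := 'rV[R]_d.

Definition dotv (x y : vec) : R := \sum_(j < d) x ord0 j * y ord0 j.
Definition enorm (x : vec) : R := Num.sqrt (dotv x x).

Definition is_gradient (f : vec -> R) (g : vec -> vec) : Prop :=
  forall x : vec, differentiable f x /\ forall h : vec, 'd f x h = dotv (g x) h.

Definition convex_fn (f : vec -> R) : Prop :=
  forall (x y : vec) (t : R), 0 <= t <= 1 ->
    f ((1 - t) *: x + t *: y) <= (1 - t) * f x + t * f y.

Definition L_smooth_grad (L : R) (g : vec -> vec) : Prop :=
  forall x y : vec, enorm (g x - g y) <= L * enorm (x - y).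

Definition is_minimizer (f : vec -> R) (xs : vec) : Prop :=
  forall x : vec, f xs <= f x.

Variable n : nat.

Definition avgf (f : 'I_n -> vec -> R) (x : vec) : R := n%:R^-1 * \sum_i f i x.
Definition avgg (g : 'I_n -> vec -> vec) (x : vec) : vec := n%:R^-1 *: \sum_i g i x.

Definition pprob : R := n%:R^-1.

Definition alpha_eq (L delta a : R) : Prop :=
  (1 - pprob * (a + delta) / (a + L + delta)) * (1 + delta / a) ^+ 2 = 1.

(* the unique positive root alpha *)
Definition alpha (L delta : R) : R :=
  xget 0 [set a : R | 0 < a /\ alpha_eq L delta a].

Definition tau_x (L delta : R) : R :=
  (alpha L delta + delta) / (alpha L delta + L + delta).

Definition tau_z (L delta : R) : R :=
  tau_x L delta / delta - alpha L delta * (1 - tau_x L delta) / (delta * L).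

Definition C_IFC (L delta : R) : R :=
  2 * L + 2 * L * alpha L delta ^+ 2 * pprob
          / ((L + (1 - pprob) * (alpha L delta + delta)) * delta).

Definition ifc_break (L delta : R) (k : nat) : bool :=
  Num.sqrt (C_IFC L delta / (2 * delta)) <= (1 + delta / alpha L delta) ^+ k.

Definition inner_break (L delta : R) : nat :=
  xget 0%N [set k : nat | ifc_break L delta k /\
                          forall j : nat, (j < k)%N -> ~~ ifc_break L delta j].

Variables (g : 'I_n -> vec -> vec) (x0 : vec) (L : R).

Definition greg (delta : R) (i : 'I_n) (x : vec) : vec := g i x + delta *: (x - x0).
Definition fgreg (delta : R) (x : vec) : vec := n%:R^-1 *: \sum_i greg delta i x.

Definition y_of (delta : R) (z xt : vec) : vec :=
  tau_x L delta *: z + (1 - tau_x L delta) *: xt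
  + tau_z L delta *: (delta *: (xt - z) - fgreg delta xt).

Definition G_of (delta : R) (i : 'I_n) (y xt : vec) : vec :=
  greg delta i y - greg delta i xt + fgreg delta xt.

Definition z_obj (delta : R) (G z y x : vec) : R :=
  dotv G x + alpha L delta / 2 * enorm (x - z) ^+ 2 + delta / 2 * enorm (x - y) ^+ 2.

Definition z_next (delta : R) (G z y : vec) : vec :=
  xget 0 [set x : vec | forall u : vec, z_obj delta G z y x <= z_obj delta G z y u].

(* a random sample (i, c) : 'I_n * 'I_n, uniform; i is i_k and the
   snapshot update happens iff c = 0, i.e. with probability p = 1/n *)
Definition coin (a : 'I_n * 'I_n) : bool := (val a.2 == 0)%N.

Fixpoint xt_traj (delta : R) (s : seq ('I_n * 'I_n)) (z xt : vec) : seq vec :=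
  xt :: match s with
        | [::] => [::]
        | a :: s' =>
            let y := y_of delta z xt in
            let z' := z_next delta (G_of delta a.1 y xt) z y in
            xt_traj delta s' z' (if coin a then y else xt)
        end.

Definition stop_test (eps : R) (x : vec) : bool := enorm (avgg g x) <= eps.

Definition loop_xts (delta : R) (s : seq ('I_n * 'I_n)) : seq vec :=
  take (inner_break L delta).+1 (xt_traj delta s x0 x0).

Definition loop_terminates (eps delta : R) (s : seq ('I_n * 'I_n)) : bool :=
  has (stop_test eps) (loop_xts delta s).

Definition loop_iters (eps delta : R) (s : seq ('I_n * 'I_n)) : nat :=
  minn (find (stop_test eps) (loop_xts delta s)).+1 (inner_break L delta).+1.

(* oracle cost: iteration k evaluates grad f_{i_k}(y_k), grad f_{i_k}(xt_k) (2)
   plus the full gradient grad f^delta(xt_k) (n) when xt_k is a new snapshot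
   (k = 0, or the snapshot was updated at iteration k-1). *)
Definition loop_cost (eps delta : R) (s : seq ('I_n * 'I_n)) : nat :=
  (\sum_(k < loop_iters eps delta s)
     (2 + (if (k == 0 :> nat) || nth false (map coin s) k.-1 then n else 0)))%N.

Definition delta_t (beta : R) (t : nat) : R := L / beta ^+ t.

Definition first_outer (beta dstar : R) : nat :=
  xget 0%N [set t : nat | delta_t beta t <= dstar /\
                          forall j : nat, (j < t)%N -> ~ delta_t beta j <= dstar].

(* number of random samples reserved per outer loop (enough for loops 0..l) *)
Definition samples_len (beta : R) (l : nat) : nat :=
  (\max_(t < l.+1) (inner_break L (delta_t beta t)).+1)%N.

Definition samples (l M : nat) (w : {ffun 'I_l.+1 * 'I_M -> 'I_n * 'I_n})
  (t : 'I_l.+1) : seq ('I_n * 'I_n) := [seq w (t, j) | j <- enum 'I_M].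

Definition run_cost (eps beta : R) (l M : nat)
  (w : {ffun 'I_l.+1 * 'I_M -> 'I_n * 'I_n}) : nat :=
  (\sum_(t < l.+1)
     (if [forall t' : 'I_l.+1, (t' < t)%N ==>
            ~~ loop_terminates eps (delta_t beta t') (samples w t')]
      then loop_cost eps (delta_t beta t) (samples w t) else 0))%N.

End Vec.

Definition uprob (T : finType) (A : pred T) : R := #|A|%:R / #|T|%:R.
Definition uexpect (T : finType) (X : T -> R) : R := #|T|%:R^-1 * \sum_(w : T) X w.

End RAccSVRG.

(* Main.v *)
Require Import Defs.
From HB Require Import structures.
From mathcomp Require Import all_boot all_order all_algebra.
From mathcomp Require Import all_classical all_reals all_analysis.
From mathcomp Require Import ring lra.
Import Order.TTheory GRing.Theory Num.Theory.
Import numFieldNormedType.Exports.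
Local Open Scope ring_scope.
Local Open Scope classical_set_scope.

(* Fix delta, let xd be the minimizer of f^delta and put
   h x = f x - f xd - <grad f xd, x - xd>. Per inner iteration, the Lyapunov
   function h x + lambda / 2 |z - xd|^2, lambda = alpha^2 p / (L + (1 - p)(alpha + delta)),
   contracts in expectation by (1 + delta / alpha)^-2: the equation of alpha makes
   this rate equal to 1 - p tau_x, and tau_z = 1 / (alpha + L + delta) makes the
   mixed term <grad h y, grad h x> cancel. Since grad f = grad h + grad f xd with
   |grad h|^2 <= 2 L h and |grad f xd| = delta |xd - x0| <= sqrt (2 delta Delta0),
   Markov's inequality gives (i).
   For (ii), the equation of alpha gives alpha / delta <= 4 n + 2 sqrt (n L / delta)
   and lambda <= 2 delta, hence C_IFC / (2 delta) <= 3 L / delta. So outer loop t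
   makes O((n + sqrt (n beta^t)) ln (3 beta^t)) iterations, each of expected cost 3
   after the first, and these bounds sum geometrically in sqrt beta. *)

(** * Euclidean geometry and smooth convex functions *)

Section Euclidean.
Context {R : realType} {d : nat}.
Local Notation vec := 'rV[R]_d.
Implicit Types (x y z : vec) (a : R).

Lemma dotvC x y : dotv x y = dotv y x.
Proof. by apply: eq_bigr => j _; rewrite mulrC. Qed.

Lemma dotvDl x y z : dotv (x + y) z = dotv x z + dotv y z.
Proof.
by rewrite /dotv -big_split /=; apply: eq_bigr => j _; rewrite mxE mulrDl.
Qed.

Lemma dotvZl a x y : dotv (a *: x) y = a * dotv x y.
Proof. by rewrite /dotv mulr_sumr; apply: eq_bigr => j _; rewrite mxE mulrA. Qed.

Lemma dotvNl x y : dotv (- x) y = - dotv x y.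
Proof. by rewrite -scaleN1r dotvZl mulN1r. Qed.

Lemma dotvDr x y z : dotv z (x + y) = dotv z x + dotv z y.
Proof. by rewrite dotvC dotvDl !(dotvC z). Qed.

Lemma dotvZr a x y : dotv y (a *: x) = a * dotv y x.
Proof. by rewrite dotvC dotvZl (dotvC y). Qed.

Lemma dotvNr x y : dotv y (- x) = - dotv y x.
Proof. by rewrite dotvC dotvNl (dotvC y). Qed.

Lemma dotv0l x : dotv 0 x = 0.
Proof. by rewrite -(scale0r 0) dotvZl mul0r. Qed.

Lemma dotv_suml (I : finType) (F : I -> vec) y :
  dotv (\sum_i F i) y = \sum_i dotv (F i) y.
Proof.
by apply: (big_morph (fun x => dotv x y)) => [u v|]; rewrite ?dotvDl ?dotv0l.
Qed.

Definition dotvE := (dotvDl, dotvDr, dotvNl, dotvNr, dotvZl, dotvZr).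

Lemma dotv_ge0 x : 0 <= dotv x x.
Proof. by apply: sumr_ge0 => j _; rewrite -expr2 sqr_ge0. Qed.

Lemma dotv_eq0 x : dotv x x = 0 -> x = 0.
Proof.
move/eqP; rewrite psumr_eq0 => [/allP xx0|j _]; last by rewrite -expr2 sqr_ge0.
apply/rowP => j; rewrite mxE; apply/eqP.
by have := xx0 j (mem_index_enum j); rewrite -expr2 sqrf_eq0.
Qed.

Lemma enorm_ge0 x : 0 <= enorm x.
Proof. exact: sqrtr_ge0. Qed.

Lemma enorm_sq x : enorm x ^+ 2 = dotv x x.
Proof. by rewrite sqr_sqrtr // dotv_ge0. Qed.

Lemma enormZ a x : 0 <= a -> enorm (a *: x) = a * enorm x.
Proof.
by move=> a0; rewrite /enorm dotvZl dotvZr mulrA -expr2 sqrtrM ?sqr_ge0 // sqrtr_sqr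
  ger0_norm.
Qed.

(** Cauchy-Schwarz: expand the squared norm of [enorm y *: x - enorm x *: y] and divide by twice the
    product of the norms; zero vectors are treated apart. *)
Lemma dotv_le_enorm x y : dotv x y <= enorm x * enorm y.
Proof.
have [x0|xN0] := eqVneq (enorm x) 0.
  have -> : x = 0 by apply: dotv_eq0; rewrite -enorm_sq x0 expr0n.
  by rewrite dotv0l mulr_ge0 // enorm_ge0.
have [y0|yN0] := eqVneq (enorm y) 0.
  have -> : y = 0 by apply: dotv_eq0; rewrite -enorm_sq y0 expr0n.
  by rewrite dotvC dotv0l mulr_ge0 // enorm_ge0.
have xy_gt0 : 0 < enorm x * enorm y.
  by rewrite mulr_gt0 // lt0r enorm_ge0 ?xN0 ?yN0.
have := dotv_ge0 (enorm y *: x - enorm x *: y).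
rewrite !dotvE (dotvC y x) -!enorm_sq => h.
have {}h : 0 <= enorm x * enorm y * (enorm x * enorm y - dotv x y) by lra.
by move: h; rewrite pmulr_rge0 // subr_ge0.
Qed.

Lemma ler_enormD x y : enorm (x + y) <= enorm x + enorm y.
Proof.
rewrite -(@ler_pXn2r _ 2) ?nnegrE ?addr_ge0 ?enorm_ge0 //.
rewrite enorm_sq !dotvE (dotvC y x) sqrrD !enorm_sq.
by have := dotv_le_enorm x y; lra.
Qed.

(** The topology on row vectors comes from the sup norm; this comparison turns Euclidean bounds into
    topological boundedness. *)
Lemma mx_norm_le_enorm x : `|x| <= enorm x.
Proof.
rewrite [leLHS]/Num.norm /= mx_normrE; apply/bigmax_leP; split=> [|[i j] _ /=].
  exact: enorm_ge0.
rewrite (ord1 i) -(@ler_pXn2r _ 2) ?nnegrE ?enorm_ge0 // enorm_sq real_normK ?num_real //.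
rewrite /dotv (bigD1 j) //= -expr2 lerDl; apply: sumr_ge0 => k _.
by rewrite -expr2 sqr_ge0.
Qed.

End Euclidean.

(** * Quadratic upper bound and tangent lower bound *)

Section SmoothConvex.
Context {R : realType} {d : nat}.
Local Notation vec := 'rV[R]_d.
Variables (f : vec -> R) (g : vec -> vec) (L : R).
Hypotheses (L_gt0 : 0 < L) (fg : is_gradient f g).
Hypotheses (f_cvx : convex_fn f) (g_lip : L_smooth_grad L g).

Lemma is_derive_line (u v : vec) (t : R) :
  is_derive t 1 (fun s : R => f (u + s *: v)) (dotv (g (u + t *: v)) v).
Proof.
have [df gE] := fg (u + t *: v).
have quotE : (fun h : R => h^-1 *: ((fun s : R => f (u + s *: v)) (h *: (1 : R) + t)
              - f (u + t *: v)))
    = (fun h : R => h^-1 *: (f (h *: v + (u + t *: v)) - f (u + t *: v))).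
  apply/funext => h; congr (_ *: (f _ - _)).
  by rewrite scalerDl [h *: 1]mulr1 addrCA.
split.
  rewrite /derivable quotE.
  by have := diff_derivable (v := v) df; rewrite /derivable.
by rewrite /derive quotE -gE -(deriveE v df).
Qed.

(** Mean value theorem on [0, 1] for [psi], the gap between [f] along the segment and its quadratic
    model; the Lipschitz bound on [g] makes its derivative nonpositive. *)
Lemma smooth_le (u v : vec) :
  f (u + v) <= f u + dotv (g u) v + L / 2 * dotv v v.
Proof.
pose N := dotv v v.
pose psi := fun s : R => f (u + s *: v) - (s * dotv (g u) v + L / 2 * (s ^+ 2 * N)).
pose dpsi := fun s : R => dotv (g (u + s *: v)) v - (dotv (g u) v + L * (s * N)).
have psiE (s : R) : is_derive s 1 psi (dpsi s).
  have := is_derive_line u v s => dline.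
  rewrite /psi; apply: is_deriveB.
  apply: is_derive_eq; rewrite ?scaler0 ?add0r ?addr0 /=.
  by rewrite /GRing.scale /=; field.
have psi_cont : {within `[(0:R), 1], continuous psi}.
  apply: derivable_within_continuous => s _; exact: (@ex_derive _ _ _ _ _ _ _ (psiE s)).
have [c c01] := MVT ltr01 (fun s _ => psiE s) psi_cont.
move: c01; rewrite in_itv /= => /andP[c0 c1].
rewrite /psi /dpsi scale1r scale0r addr0 subr0 mulr1.
suff : dotv (g (u + c *: v)) v - dotv (g u) v <= L * (c * N) by rewrite -/N; lra.
rewrite -dotvNl -dotvDl; apply: le_trans (dotv_le_enorm _ _) _.
rewrite {1}/N -enorm_sq expr2 !mulrA ler_wpM2r ?enorm_ge0 //.
apply: le_trans (g_lip _ _) _; rewrite (addrC u) addrK enormZ ?mulrA //.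
exact: ltW.
Qed.

(** The chord inequality and the quadratic upper bound, both taken at [y + t *: v], give the tangent
    inequality up to an error linear in [t]; then [t] is taken small. *)
Lemma convex_ge (x y : vec) : f y + dotv (g y) (x - y) <= f x.
Proof.
set v := x - y; set N := dotv v v; set D := f x - (f y + dotv (g y) v).
have N0 : 0 <= N := dotv_ge0 _.
have key t : 0 < t < 1 -> 0 <= D + 3 / 2 * L * N * t.
  move=> /andP[t0 t1].
  have := smooth_le (y + t *: v) (- (t *: v)).
  rewrite addrK !dotvE -/N => h1.
  have h2 : dotv (g y - g (y + t *: v)) (t *: v) <= L * (t ^+ 2 * N).
    rewrite -(addrC (t *: v)).
    apply: le_trans (dotv_le_enorm _ _) _.
    have := g_lip y (y + t *: v).
    have -> : y - (y + t *: v) = t *: (y - x).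
      by rewrite opprD addrA subrr add0r -scalerN opprB.
    have -> : enorm (t *: (y - x)) = enorm (t *: v).
      by rewrite /enorm -(opprB x y) scalerN dotvNl dotvNr opprK.
    move=> le1; rewrite addrC.
    apply: le_trans (ler_wpM2r (enorm_ge0 _) le1) _.
    by rewrite -mulrA -expr2 enorm_sq dotvZl dotvZr mulrA -expr2.
  have tin : 0 <= t <= 1 by rewrite !ltW.
  have h3 := f_cvx y x t tin.
  have cE : (1 - t) *: y + t *: x = y + t *: v.
    by rewrite /v scalerBl scalerBr scale1r addrAC addrA.
  rewrite cE in h3; move: h2; rewrite !dotvE => h2.
  have : 0 <= t * (D + 3 / 2 * L * N * t).
    by move: h1 h2 h3; rewrite /D /N !dotvE; lra.
  by rewrite pmulr_rge0.
rewrite -subr_ge0 -/D leNgt; apply/negP => D0.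
set c := 3 / 2 * L * N in key.
have c0 : 0 <= c by rewrite /c !mulr_ge0 // ltW.
have den : 0 < 1 + c - D by lra.
(* If [D] were negative, this [t] would lie in (0, 1) and be so small that [D + c * t] stays
   negative. *)
have := key (- D / (1 + c - D)).
rewrite divr_gt0 ?ltr_pdivrMr //=; try lra.
have -> : D + c * (- D / (1 + c - D)) = D * (1 - D) / (1 + c - D) by field; rewrite gt_eqF.
move=> /(_ ltac:(lra)); apply/negP; rewrite -ltNge.
by rewrite pmulr_llt0 ?invr_gt0 // pmulr_llt0 //; lra.
Qed.

End SmoothConvex.

(* The convex function [f - <g y, _>] is minimal at [y]; compare its value there
   with its value after a gradient step of length [1 / L] from [x]. *)
Lemma cocoercive {R : realType} {d : nat} (f : 'rV[R]_d -> R)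
    (g : 'rV[R]_d -> 'rV[R]_d) (L : R) (x y : 'rV[R]_d) :
  0 < L ->
  (forall u v, f (u + v) <= f u + dotv (g u) v + L / 2 * dotv v v) ->
  (forall u v, f v + dotv (g v) (u - v) <= f u) ->
  dotv (g x - g y) (g x - g y) <= 2 * L * (f x - f y - dotv (g y) (x - y)).
Proof.
move=> L_gt0 f_smooth f_convex; set r := g x - g y.
have h1 := f_smooth x (- (L^-1 *: r)).
have h2 := f_convex (x - L^-1 *: r) y.
have rE : dotv r r = dotv (g x) r - dotv (g y) r by rewrite {1}/r !dotvE.
have r2E : 2 * L * (L^-1 / 2 * dotv r r) = dotv r r by field; rewrite gt_eqF.
clearbody r; rewrite -r2E ler_pM2l ?mulr_gt0 //.
move: h1 h2; rewrite !dotvE.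
have -> : L / 2 * - - (L^-1 * (L^-1 * dotv r r)) = L^-1 / 2 * dotv r r.
  by field; rewrite gt_eqF.
have : L^-1 * dotv r r = L^-1 * dotv (g x) r - L^-1 * dotv (g y) r by rewrite rE; ring.
lra.
Qed.

(** * The regularized stationary point *)

Lemma continuous_mulc {R : realType} {T : topologicalType} (c : R) (f : T -> R) :
  continuous f -> continuous (fun x => c * f x).
Proof. by move=> fc x; apply: cvgM; [exact: cvg_cst|exact: fc]. Qed.

Lemma continuous_dotv_shift {R : realType} {d : nat} (x0 : 'rV[R]_d) :
  continuous (fun x : 'rV[R]_d => dotv (x - x0) (x - x0)).
Proof.
have coordC (j : 'I_d) : continuous (fun y : 'rV[R]_d => (y - x0) ord0 j).
  have -> : (fun y : 'rV[R]_d => (y - x0) ord0 j) = (fun y => y ord0 j - x0 ord0 j).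
    by apply/funext => y; rewrite !mxE.
  by move=> x; apply: continuousB; [exact: coord_continuous|exact: cst_continuous].
apply: continuous_big => [|j _ x]; first exact: add_continuous.
by apply: continuousM; exact: coordC.
Qed.

(** The regularized function is coercive because [F] is bounded below, so it attains its minimum;
    stationarity is then read off the quadratic upper bound. *)
Lemma exists_regularized_stationary {R : realType} {d : nat} (F : 'rV[R]_d -> R)
    (G : 'rV[R]_d -> 'rV[R]_d) (L delta m : R) (x0 : 'rV[R]_d) :
  0 < L -> 0 < delta -> continuous F -> (forall x, m <= F x) ->
  (forall u v, F (u + v) <= F u + dotv (G u) v + L / 2 * dotv v v) ->
  exists x, G x = - (delta *: (x - x0)).
Proof.
move=> L0 d0 Fc Fm FG.
pose Phi (x : 'rV[R]_d) := F x + delta / 2 * dotv (x - x0) (x - x0).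
have Phic : continuous Phi.
  move=> x; rewrite /continuous_at /Phi; apply: cvgD; [exact: nbhs_filter|exact: Fc|].
  by apply: continuous_mulc x; exact: continuous_dotv_shift.
pose A := [set x | Phi x <= Phi x0].
have A0 : A !=set0 by exists x0; rewrite /A /=.
have Abnd : bounded_set A.
  (* On [A], delta / 2 |x - x0|^2 is at most [F x0 - m]; the bound r <= 1 + r^2 avoids a square
     root. *)
  exists (`|x0| + (1 + 2 / delta * (F x0 - m))); split; first exact: num_real.
  move=> N ltN x; rewrite /A /Phi /= subrr dotv0l mulr0 addr0 => Ax.
  apply: le_trans (ltW ltN).
  rewrite -[x in `|x|](subrK x0) addrC; apply: le_trans (ler_normD _ _) _.
  rewrite lerD2l; apply: le_trans (mx_norm_le_enorm _) _.
  have : enorm (x - x0) <= 1 + enorm (x - x0) ^+ 2.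
    by have := sqr_ge0 (enorm (x - x0) - 1 / 2); lra.
  rewrite enorm_sq => /le_trans; apply.
  rewrite lerD2l -(@ler_pM2l _ (delta / 2)) ?divr_gt0 //.
  have -> : delta / 2 * (2 / delta * (F x0 - m)) = F x0 - m.
    by field; rewrite gt_eqF.
  by have := Fm x; lra.
have Acl : closed A.
  have -> : A = Phi @^-1` [set y | y <= Phi x0] by [].
  apply: closed_comp; first by move=> x _; exact: Phic.
  exact: closed_le.
have [|c cA cmin] := compact_EVT_min A0 (bounded_closed_compact Abnd Acl) (f := Phi).
  exact: continuous_subspaceT.
have {}cmin x : Phi c <= Phi x.
  have [xA|] := leP (Phi x) (Phi x0); first by apply: cmin; rewrite inE.
  by move=> /ltW; apply: le_trans; move: cA; rewrite inE.
exists c; apply/eqP; rewrite -addr_eq0; apply/eqP.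
(* [w] acts as the gradient of [Phi] at the minimizer [c]: moving by [- (s *: w)] lowers [Phi] by at
   least s / 2 |w|^2, which forces [w = 0]. *)
set w := G c + _; apply: dotv_eq0; apply/eqP; rewrite eq_le dotv_ge0 andbT.
have Ld : 0 < L + delta by lra.
set s := (L + delta)^-1; have s0 : 0 < s by rewrite invr_gt0.
have h1 := FG c (- (s *: w)).
have := cmin (c + - (s *: w)); rewrite /Phi (addrAC c) => h2.
have wE : dotv w w = dotv (G c) w + delta * dotv (c - x0) w by rewrite {1}/w dotvDl dotvZl.
move: h1 h2; clearbody w; set u := c - x0 in wE *; clearbody u.
rewrite !dotvE (dotvC w u) => h1 h2.
have : 0 <= - s * dotv w w + (L + delta) * s * (s / 2 * dotv w w) by rewrite {1}wE; lra.
rewrite divff ?gt_eqF // mul1r => h3.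
have : 0 <= (s / 2) * - dotv w w by lra.
by rewrite pmulr_rge0 ?oppr_ge0 // divr_gt0.
Qed.

(** * Averages over the components *)

Section Average.
Context {R : realType} {n d : nat}.
Variables (f : 'I_n -> 'rV[R]_d -> R) (g : 'I_n -> 'rV[R]_d -> 'rV[R]_d) (L : R).
Hypotheses (n_gt0 : (0 < n)%N) (L_gt0 : 0 < L).
Hypotheses (fg : forall i, is_gradient (f i) (g i)).
Hypotheses (f_cvx : forall i, convex_fn (f i)).
Hypotheses (g_lip : forall i, L_smooth_grad L (g i)).

Lemma avg_const (c : R) : n%:R^-1 * \sum_(i < n) c = c.
Proof.
by rewrite sumr_const card_ord -[X in _ * X]mulr_natl mulKf // pnatr_eq0 -lt0n.
Qed.

Lemma ler_avg (a b : 'I_n -> R) : (forall i, a i <= b i) ->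
  n%:R^-1 * \sum_i a i <= n%:R^-1 * \sum_i b i.
Proof. by move=> ab; rewrite ler_wpM2l ?invr_ge0 // ler_sum. Qed.

Lemma avgfD (a b : 'I_n -> R) : n%:R^-1 * \sum_i (a i + b i) =
  n%:R^-1 * \sum_i a i + n%:R^-1 * \sum_i b i.
Proof. by rewrite big_split mulrDr. Qed.

Lemma avgfZ c (a : 'I_n -> R) : n%:R^-1 * \sum_i (c * a i) = c * (n%:R^-1 * \sum_i a i).
Proof. by rewrite -mulr_sumr mulrCA. Qed.

Lemma avgfN (a : 'I_n -> R) : n%:R^-1 * \sum_i (- a i) = - (n%:R^-1 * \sum_i a i).
Proof. by rewrite sumrN mulrN. Qed.

Lemma avg_dotv (w : 'I_n -> 'rV[R]_d) v :
  n%:R^-1 * \sum_i dotv (w i) v = dotv (n%:R^-1 *: \sum_i w i) v.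
Proof. by rewrite dotvZl dotv_suml. Qed.

Lemma avg_smooth_le u v :
  avgf f (u + v) <= avgf f u + dotv (avgg g u) v + L / 2 * dotv v v.
Proof.
rewrite -(avg_const (L / 2 * _)) -avg_dotv -!avgfD; apply: ler_avg => i.
exact: smooth_le.
Qed.

Lemma avg_convex_ge x y : avgf f y + dotv (avgg g y) (x - y) <= avgf f x.
Proof. by rewrite -avg_dotv -!avgfD; apply: ler_avg => i; exact: (convex_ge _ _ L). Qed.

Lemma avg_continuous : continuous (avgf f).
Proof.
apply: continuous_mulc; apply: continuous_big => [|i _ x]; first exact: add_continuous.
by apply: differentiable_continuous; have [] := fg i x.
Qed.

End Average.

(** * The constants of the algorithm *)

Section AlgorithmConstants.
Context {R : realType} {n : nat}.
Variables (L delta : R).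
Hypotheses (n_gt0 : (0 < n)%N) (L_gt0 : 0 < L) (delta_gt0 : 0 < delta).
Local Notation p := (pprob R n).
Local Notation alpha := (alpha n L delta).

Lemma pprob_gt0 : 0 < p.
Proof. by rewrite invr_gt0 ltr0n. Qed.

Lemma pprob_le1 : p <= 1.
Proof. by rewrite invf_le1 ?ltr0n // ler1n. Qed.

Lemma mulr_natp : n%:R * p = 1.
Proof. by rewrite divff // pnatr_eq0 -lt0n. Qed.

(** With S = L + (1 - p)(a + delta), the equation reads S (a + delta)^2 = a^2 (S + p (a + delta));
    collecting S gives this cubic form. *)
Lemma alpha_eqE (a : R) : 0 < a -> alpha_eq n L delta a <->
  p * a ^+ 2 * (a + delta) =
  (2 * a * delta + delta ^+ 2) * (L + (1 - p) * (a + delta)).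
Proof.
have [L0 d0] := (L_gt0, delta_gt0).
move=> a0; have aN0 : a != 0 by rewrite gt_eqF.
have S0 : a + L + delta != 0 by rewrite gt_eqF //; lra.
have -> : alpha_eq n L delta a =
    ((a + L + delta - p * (a + delta)) * (a + delta) ^+ 2 =
     a ^+ 2 * (a + L + delta)).
  rewrite /alpha_eq; apply/propext; split => [eq1|eq2].
    rewrite -[RHS]mulr1 -[in RHS]eq1; field; exact/andP.
  apply: (@mulfI _ (a ^+ 2 * (a + L + delta))).
    by rewrite mulf_neq0 // expf_neq0.
  rewrite mulr1 -[RHS]eq2; field; exact/andP.
split=> h; lra.
Qed.

(** A point from which on the cubic is positive: it is both the right end for the intermediate value
    theorem and the a priori bound on [alpha]. *)
Definition alpha_bound : R := delta * (4 * n%:R + 2 * Num.sqrt (n%:R * (L / delta))).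

Let alpha_bound_ge : 4 * n%:R * delta <= alpha_bound.
Proof.
by have := sqrtr_ge0 (n%:R * (L / delta)); rewrite /alpha_bound => s0;
  have := mulr_ge0 (ltW delta_gt0) s0; lra.
Qed.

Let above_bound (a : R) : alpha_bound <= a ->
  (2 * a * delta + delta ^+ 2) * (L + (1 - p) * (a + delta)) <
  p * a ^+ 2 * (a + delta).
Proof.
have [L0 d0] := (L_gt0, delta_gt0).
rewrite /alpha_bound; set s := Num.sqrt (n%:R * (L / delta)).
have s0 : 0 <= s by exact: sqrtr_ge0.
have n1 : 1 <= n%:R :> R by rewrite ler1n.
have s2 : s ^+ 2 = n%:R * (L / delta).
  by rewrite sqr_sqrtr // mulr_ge0 ?divr_ge0 // ltW.
move=> ha; have [p0 p1] := (pprob_gt0, pprob_le1).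
pose u := a / delta.
have aE : a = delta * u by rewrite /u mulrC divfK // gt_eqF.
have LE : L = delta * (p * s ^+ 2).
  by rewrite s2 /pprob; field; rewrite !gt_eqF // ltr0n.
have ub : 4 * n%:R + 2 * s <= u by rewrite -(ler_pM2l delta_gt0) -aE.
have u4 : 4 <= u by lra.
(* In the scaled variables a = delta u and L = delta p s^2 a quadratic inequality remains;
   multiplied by n it follows from [ub], where 2 s absorbs s^2 and 4 n absorbs the rest. *)
have key : p * s ^+ 2 + u + 1 < p * u ^+ 2 / 2.
  have : n%:R * (p * s ^+ 2 + u + 1) < n%:R * (p * u ^+ 2 / 2).
    have -> : n%:R * (p * s ^+ 2 + u + 1) = n%:R * p * s ^+ 2 + n%:R * (u + 1) by ring.
    have -> : n%:R * (p * u ^+ 2 / 2) = n%:R * p * (u ^+ 2 / 2) by ring.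
    rewrite mulr_natp !mul1r.
    have uu : (4 * n%:R + 2 * s) * u <= u ^+ 2 by rewrite expr2 ler_wpM2r //; lra.
    have su : s * (2 * s) <= s * u by rewrite ler_wpM2l //; lra.
    have nu : n%:R * 4 <= n%:R * u by rewrite ler_wpM2l //; lra.
    nra.
  by rewrite ltr_pM2l // ltr0n.
rewrite LE aE.
have -> : (2 * (delta * u) * delta + delta ^+ 2) *
    (delta * (p * s ^+ 2) + (1 - p) * (delta * u + delta)) =
    delta ^+ 3 * ((2 * u + 1) * (p * s ^+ 2 + (1 - p) * (u + 1))) by ring.
have -> : p * (delta * u) ^+ 2 * (delta * u + delta) =
    delta ^+ 3 * (2 * (u + 1) * (p * u ^+ 2 / 2)) by field.
rewrite ltr_pM2l ?exprn_gt0 //.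
have key2 : p * s ^+ 2 + (1 - p) * (u + 1) < p * u ^+ 2 / 2.
  have : 0 <= p * (u + 1) by rewrite mulr_ge0 //; lra.
  lra.
apply: (@le_lt_trans _ _ (2 * (u + 1) * (p * s ^+ 2 + (1 - p) * (u + 1)))).
  apply: ler_wpM2r; last by lra.
  by rewrite addr_ge0 // mulr_ge0 ?sqr_ge0 //; lra.
by rewrite ltr_pM2l //; lra.
Qed.

Lemma alpha_le (a : R) : 0 < a -> alpha_eq n L delta a -> a <= alpha_bound.
Proof.
move=> a0 /(alpha_eqE _ a0) eqa; rewrite leNgt; apply/negP => /ltW /above_bound.
by rewrite eqa ltxx.
Qed.

(** Intermediate value theorem for the cubic on [0, [alpha_bound]]; its value at 0 is negative, so
    the root is positive. *)
Lemma alpha_exists : exists a, 0 < a /\ alpha_eq n L delta a.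
Proof.
have [L0 d0] := (L_gt0, delta_gt0).
have p1 := pprob_le1.
pose P : {poly R} := p *: 'X^2 * ('X + delta%:P) -
  ((2 * delta) *: 'X + (delta ^+ 2)%:P) * (L%:P + (1 - p) *: ('X + delta%:P)).
have PE a : P.[a] = p * a ^+ 2 * (a + delta) -
    (2 * delta * a + delta ^+ 2) * (L + (1 - p) * (a + delta)).
  by rewrite /P !hornerE.
have P0 : P.[0] < 0.
  rewrite PE expr0n /= !mulr0 mul0r !add0r oppr_lt0.
  rewrite mulr_gt0 ?exprn_gt0 // ltr_wpDr // mulr_ge0 //; lra.
have n1 : 1 <= n%:R :> R by rewrite ler1n.
have bound0 : 0 <= alpha_bound.
  by apply: le_trans alpha_bound_ge; rewrite !mulr_ge0 // ltW.
have [|a /andP[a0 _] /rootP Pa] := poly_ivt (p := P) bound0.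
  by rewrite (ltW P0) PE subr_ge0 mulrAC ltW // above_bound.
have {}a0 : 0 < a.
  by rewrite lt_def a0 andbT; apply/eqP => aE; move: P0; rewrite -[X in P.[X]]aE Pa ltxx.
exists a; split=> //; apply/(alpha_eqE _ a0); move: Pa; rewrite PE; lra.
Qed.

Lemma alpha_spec : 0 < alpha /\ alpha_eq n L delta alpha.
Proof. exact: (xgetPex 0 alpha_exists). Qed.

Lemma alpha_gt0 : 0 < alpha.
Proof. by have [] := alpha_spec. Qed.

(** The weight lambda of the squared distance; 2 L / delta times it is the second summand of
    [C_IFC]. *)
Definition lyap_weight : R := alpha ^+ 2 * p / (L + (1 - p) * (alpha + delta)).

Let S_gt0 : 0 < L + (1 - p) * (alpha + delta).
Proof.
have [L0 d0] := (L_gt0, delta_gt0).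
have [a0 p1] := (alpha_gt0, pprob_le1).
by apply: ltr_wpDr => //; apply: mulr_ge0; lra.
Qed.

Let T : R := (alpha + L + delta)^-1.

Let D_neq0 : alpha + L + delta != 0.
Proof.
have [L0 d0] := (L_gt0, delta_gt0).
by have a0 := alpha_gt0; rewrite gt_eqF //; lra.
Qed.

Lemma lyap_weight_ge0 : 0 <= lyap_weight.
Proof.
apply: divr_ge0; last exact: ltW.
by apply: mulr_ge0; [exact: sqr_ge0|exact: ltW pprob_gt0].
Qed.

(** The cubic gives lambda (alpha + delta) = 2 alpha delta + delta^2, which is at most 2 delta
    (alpha + delta). *)
Lemma lyap_weight_le : lyap_weight <= 2 * delta.
Proof.
have [L0 d0] := (L_gt0, delta_gt0).
have [a0 /(alpha_eqE _ a0) aE] := alpha_spec.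
rewrite /lyap_weight ler_pdivrMr // -(@ler_pM2r _ (alpha + delta)); last by lra.
have -> : alpha ^+ 2 * p * (alpha + delta) = p * alpha ^+ 2 * (alpha + delta) by ring.
rewrite aE.
have -> : 2 * delta * (L + (1 - p) * (alpha + delta)) * (alpha + delta) =
  (2 * alpha * delta + 2 * delta ^+ 2) * (L + (1 - p) * (alpha + delta)) by ring.
by rewrite ler_pM2r // lerD2l; have := sqr_ge0 delta; lra.
Qed.

Lemma rateE : (1 + delta / alpha) ^- 2 = 1 - p * (alpha + delta) * T.
Proof.
have [a0 ] := alpha_spec; rewrite /alpha_eq => aE.
have r0 : (1 + delta / alpha) ^+ 2 != 0.
  by rewrite expf_neq0 // gt_eqF //; apply: addr_gt0 => //; exact: divr_gt0.
by apply: (mulIf r0); rewrite mulVf //; exact/esym.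
Qed.

(** After a [z] step the squared distance carries the factor (alpha + delta)^-2; this identity turns
    its weight into p T, on the scale of the function values. *)
Lemma lyap_weight_rate : lyap_weight / (alpha + delta) ^+ 2 = p * T.
Proof.
have [L0 d0] := (L_gt0, delta_gt0).
have [a0 /(alpha_eqE _ a0) aE] := alpha_spec.
have AN0 : alpha + delta != 0 by rewrite gt_eqF //; lra.
apply/eqP; rewrite /lyap_weight /T -mulrA -invfM eqr_div ?mulf_neq0 ?expf_neq0 //; last first.
  by rewrite gt_eqF.
apply/eqP.
have -> : alpha ^+ 2 * p * (alpha + L + delta) = p * (
   alpha ^+ 2 * (L + (1 - p) * (alpha + delta)) + p * alpha ^+ 2 * (alpha + delta)) by ring.
by rewrite aE; ring.
Qed.

Lemma tau_xE : tau_x n L delta = (alpha + delta) * T.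
Proof. by []. Qed.

(** Since 1 - tau_x = L T, the quotient is ((alpha + delta) T - alpha T) / delta. *)
Lemma tau_zE : tau_z n L delta = T.
Proof.
rewrite /tau_z tau_xE /T; field.
by rewrite D_neq0 !gt_eqF.
Qed.

Lemma C_IFC_E : C_IFC n L delta = 2 * L * (1 + lyap_weight / delta).
Proof. by rewrite /C_IFC /lyap_weight; field; rewrite !gt_eqF. Qed.

End AlgorithmConstants.

Arguments lyap_weight {R} n L delta.
Arguments alpha_bound {R} n L delta.

(** * One inner iteration *)

Section Expectation.
Context {R : realType} {T : finType}.
Implicit Types X Y : T -> R.

Lemma ler_uexpect X Y : (forall w, X w <= Y w) -> uexpect X <= uexpect Y.
Proof. by move=> XY; rewrite ler_wpM2l ?invr_ge0 // ler_sum. Qed.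

Lemma eq_uexpect X Y : X =1 Y -> uexpect X = uexpect Y.
Proof. by move=> XY; rewrite /uexpect (eq_bigr _ (fun w _ => XY w)). Qed.

Lemma uexpectD X Y : uexpect (fun w => X w + Y w) = uexpect X + uexpect Y.
Proof. by rewrite /uexpect big_split mulrDr. Qed.

Lemma uexpectZ c X : uexpect (fun w => c * X w) = c * uexpect X.
Proof. by rewrite /uexpect -mulr_sumr mulrCA. Qed.

Lemma uexpect_sum (I : finType) (F : I -> T -> R) :
  uexpect (fun w => \sum_i F i w) = \sum_i uexpect (F i).
Proof. by rewrite /uexpect exchange_big mulr_sumr. Qed.

Lemma uexpect_const (c : R) : (0 < #|T|)%N -> uexpect (fun _ : T => c) = c.
Proof.
move=> T0; rewrite /uexpect sumr_const -[X in _ * X]mulr_natl mulKf //.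
by rewrite pnatr_eq0 -lt0n.
Qed.

End Expectation.

Section Sample.
Context {R : realType} {n : nat}.
Hypothesis n_gt0 : (0 < n)%N.
Local Notation p := (pprob R n).

Lemma sum_coin (v : bool -> R) :
  \sum_(j < n) v (val j == 0)%N = v true + (n%:R - 1) * v false.
Proof.
case: n n_gt0 => // m _; rewrite big_ord_recl /=; congr (_ + _).
by rewrite (eq_bigr (fun=> v false)) // sumr_const card_ord -natr1 addrK mulr_natl.
Qed.

(** The Lyapunov function after one step has this split form: the new [z] depends on the index only,
    the new snapshot on the coin only. *)
Lemma uexpect_index_coin (u : 'I_n -> R) (v : bool -> R) :
  uexpect (fun a : 'I_n * 'I_n => u a.1 + v (coin a)) =
  n%:R^-1 * \sum_i u i + (p * v true + (1 - p) * v false).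
Proof.
have n0 : n%:R != 0 :> R by rewrite pnatr_eq0 -lt0n.
rewrite uexpectD /uexpect card_prod card_ord natrM /coin.
rewrite -(pair_big xpredT xpredT (fun i j : 'I_n => u i)) /=.
rewrite -(pair_big xpredT xpredT (fun i j : 'I_n => v (val j == 0)%N)) /=.
rewrite (eq_bigr (fun i => n%:R * u i)) => [|i _]; last first.
  by rewrite sumr_const card_ord mulr_natl.
rewrite -mulr_sumr sum_coin sumr_const card_ord -[X in _ + _ * X]mulr_natl /pprob; field.
exact: n0.
Qed.

End Sample.

(** * Contraction of the Lyapunov function *)

Section OneStep.
Context {R : realType} {n d : nat}.
Variables (f : 'I_n -> 'rV[R]_d -> R) (g : 'I_n -> 'rV[R]_d -> 'rV[R]_d).
Variables (L delta : R) (x0 xd : 'rV[R]_d).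
Hypotheses (n_gt0 : (0 < n)%N) (L_gt0 : 0 < L) (delta_gt0 : 0 < delta).
Hypotheses (fg : forall i, is_gradient (f i) (g i)).
Hypotheses (f_cvx : forall i, convex_fn (f i)).
Hypotheses (g_lip : forall i, L_smooth_grad L (g i)).
Hypothesis (xd_stat : avgg g xd = - (delta *: (xd - x0))).
Local Notation p := (pprob R n).
Local Notation alpha := (alpha n L delta).

(** Completing the square writes the objective as its value at [zm] plus a positive multiple of |x -
    zm|^2, so [zm] is the only minimizer [xget] can return. *)
Lemma z_nextE (G z y : 'rV[R]_d) :
  z_next n L delta G z y =
  (alpha + delta)^-1 *: (alpha *: z + delta *: y - G).
Proof.
have a0 := alpha_gt0 _ _ n_gt0 L_gt0 delta_gt0; have d0 := delta_gt0.
have A0 : 0 < alpha + delta by lra.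
set zm := _ *: _.
have stat : (alpha + delta) *: zm = alpha *: z + delta *: y - G.
  by rewrite scalerA divff ?scale1r // gt_eqF.
have objE x : z_obj n L delta G z y x =
    z_obj n L delta G z y zm + (alpha + delta) / 2 * dotv (x - zm) (x - zm).
  have GE : G = alpha *: z + delta *: y - (alpha + delta) *: zm.
    by rewrite stat opprB addrC subrK.
  clearbody zm; rewrite /z_obj !enorm_sq GE !dotvE (dotvC z x) (dotvC y x) (dotvC zm x).
  by rewrite (dotvC zm z) (dotvC zm y); field.
apply: xget_unique => [u|x xmin].
  by rewrite (objE u) lerDl mulr_ge0 ?dotv_ge0 //; lra.
have := xmin zm; rewrite objE gerDl pmulr_rle0; last by lra.
move=> le0; apply/eqP; rewrite -subr_eq0; apply/eqP/dotv_eq0/eqP.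
by rewrite eq_le le0 dotv_ge0.
Qed.

(** The Bregman divergence of [avgf f] at [xd]; its gradient is [avgg g x - avgg g xd]. *)
Definition shifted (x : 'rV[R]_d) : R :=
  avgf f x - avgf f xd - dotv (avgg g xd) (x - xd).

Definition lyapunov (z x : 'rV[R]_d) : R :=
  shifted x + lyap_weight n L delta / 2 * dotv (z - xd) (z - xd).

(** Stationarity of [xd] recentres the regularized gradient from [x0] to [xd]. *)
Lemma fgregE x : fgreg g x0 delta x = avgg g x - avgg g xd + delta *: (x - xd).
Proof.
rewrite /fgreg /greg big_split scalerDr sumr_const card_ord /= -/(avgg g x).
rewrite -(scaler_nat n (delta *: _)) [_^-1 *: (_ *: _)]scalerA mulVf ?pnatr_eq0 -?lt0n //.
rewrite scale1r xd_stat opprK.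
by rewrite -addrA -scalerDr [xd - x0 + _]addrC subrKA.
Qed.

(** With tau_z = T, multiplying by alpha + L + delta cancels every delta on the right-hand side. *)
Lemma y_ofE z x : let m := y_of g x0 L delta z x - xd in
  (alpha + L + delta) *: m =
  alpha *: (z - xd) + L *: (x - xd) - (avgg g x - avgg g xd).
Proof.
rewrite /y_of tau_xE tau_zE // fgregE /=.
have a0 := alpha_gt0 _ _ n_gt0 L_gt0 delta_gt0; have [l0 d0] := (L_gt0, delta_gt0).
have D0 : alpha + L + delta != 0 by rewrite gt_eqF //; lra.
move: (avgg g x - avgg g xd) => q.
by apply/rowP => j; rewrite !mxE; field; exact: D0.
Qed.

(** Cocoercivity of each component, averaged; the Bregman divergences of the [f i] average to that
    of [avgf f], which is also that of [shifted]. *)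
Lemma avg_variance_le x y :
  n%:R^-1 * \sum_i dotv (g i y - g i x) (g i y - g i x) <=
  2 * L * (shifted x - shifted y - dotv (avgg g y - avgg g xd) (x - y)).
Proof.
have -> : 2 * L * (shifted x - shifted y - dotv (avgg g y - avgg g xd) (x - y)) =
    n%:R^-1 * \sum_i (2 * L * (f i x - f i y - dotv (g i y) (x - y))).
  rewrite avgfZ !avgfD !avgfN avg_dotv -/(avgg g y) -/(avgf f x) -/(avgf f y).
  by rewrite /shifted !dotvE; ring.
apply: ler_avg => i; have -> : g i y - g i x = - (g i x - g i y) by rewrite opprB.
rewrite dotvNl dotvNr opprK; apply: cocoercive => // u v.
  exact: smooth_le.
exact: (convex_ge _ _ L).
Qed.

Lemma enorm_grad_shifted x :
  enorm (avgg g x - avgg g xd) ^+ 2 <= 2 * L * shifted x.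
Proof.
rewrite enorm_sq; apply: cocoercive => // u v; first exact: avg_smooth_le.
exact: (avg_convex_ge _ _ L).
Qed.

Lemma shifted_le y : shifted y <= dotv (avgg g y - avgg g xd) (y - xd).
Proof.
rewrite /shifted dotvDl dotvNl.
have := avg_convex_ge _ _ _ L_gt0 fg f_cvx g_lip xd y.
by rewrite -opprB dotvNr; lra.
Qed.

Lemma lyapunov_step z x y : y = y_of g x0 L delta z x ->
  uexpect (fun a : 'I_n * 'I_n =>
    lyapunov (z_next n L delta (G_of g x0 delta a.1 y x) z y)
      (if coin a then y else x))
  <= (1 + delta / alpha) ^- 2 * lyapunov z x.
Proof.
move=> yE.
have a0 := alpha_gt0 _ _ n_gt0 L_gt0 delta_gt0; have [l0 d0] := (L_gt0, delta_gt0).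
have A0 : alpha + delta != 0 by rewrite gt_eqF //; lra.
have D0 : 0 < alpha + L + delta by lra.
set T := (alpha + L + delta)^-1.
have T0 : 0 < T by rewrite invr_gt0.
have TD : T * (alpha + L + delta) = 1 by rewrite mulVf // gt_eqF.
set w := z - xd; set q := avgg g x - avgg g xd; set e := avgg g y - avgg g xd.
(* The estimator of the gradient of [shifted] at [y]: [G_of] exceeds it by delta (y - xd), which the
   proximal term at [y] cancels in [zE]. *)
pose Hq i := g i y - g i x + q.
have zE i : z_next n L delta (G_of g x0 delta i y x) z y - xd =
    (alpha + delta)^-1 *: (alpha *: w - Hq i).
  rewrite z_nextE /G_of fgregE /greg /Hq /w /q.
  move: (avgg g x - avgg g xd) => q'.
  by apply/rowP => j; rewrite !mxE; field; exact: A0.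
have uE (a : 'I_n * 'I_n) :
    lyapunov (z_next n L delta (G_of g x0 delta a.1 y x) z y) (if coin a then y else x)
  = lyap_weight n L delta / 2 * ((alpha + delta) ^- 2 * (alpha ^+ 2 * dotv w w +
      - (2 * alpha) * dotv (Hq a.1) w + dotv (Hq a.1) (Hq a.1))) +
    (if coin a then shifted y else shifted x).
  rewrite /lyapunov zE (fun_if shifted) addrC; congr (_ + _).
  by move: (w) (Hq a.1) => w' H; rewrite !dotvE (dotvC w' H); field; exact: A0.
rewrite (eq_uexpect _ _ uE).
rewrite (uexpect_index_coin _ (fun i => lyap_weight n L delta / 2 * ((alpha + delta) ^- 2 *
  (alpha ^+ 2 * dotv w w + - (2 * alpha) * dotv (Hq i) w + dotv (Hq i) (Hq i))))
  (fun c => if c then shifted y else shifted x)) //.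
rewrite !avgfZ !avgfD avg_const // avgfZ avg_dotv.
have avgHq : n%:R^-1 *: \sum_i Hq i = e.
  rewrite /Hq big_split sumr_const card_ord big_split sumrN /= !scalerDr scalerN.
  rewrite -/(avgg g y) -/(avgg g x) -(scaler_nat n q).
  rewrite [_^-1 *: (_ *: q)]scalerA mulVf ?pnatr_eq0 -?lt0n //.
  by rewrite scale1r /q /e addrA subrK.
rewrite avgHq.
(* In this form of the second moment the mixed term is linear in [Hq i], so it averages to 2 <e, q>
   by unbiasedness. *)
have HqE i : dotv (Hq i) (Hq i) =
    dotv (g i y - g i x) (g i y - g i x) + 2 * dotv (Hq i) q - dotv q q.
  rewrite /Hq; move: (g i y - g i x) (q) => D q'.
  by rewrite !dotvE (dotvC q' D); ring.
rewrite (eq_bigr _ (fun i _ => HqE i)) !avgfD avgfZ avgfN avg_const // avg_dotv avgHq.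
have := avg_variance_le x y.
set DD := n%:R^-1 * _ => leDD.
have le_hy := shifted_le y.
have mE := y_ofE z x; rewrite /= -yE -/w -/q in mE.
have emE : dotv e (y - xd) = T * (alpha * dotv e w + L * dotv e (x - xd) - dotv e q).
  apply: (@mulfI _ (alpha + L + delta)); first by rewrite gt_eqF.
  rewrite -[LHS]dotvZr mE mulrA (mulrC _ T) TD mul1r.
  by rewrite !(dotvDr, dotvNr, dotvZr).
have exyE : dotv e (x - y) = dotv e (x - xd) - dotv e (y - xd).
  by rewrite -dotvNr -dotvDr opprB addrA subrK.
rewrite -/e exyE in leDD; rewrite -/e in le_hy.
rewrite rateE // /lyapunov -/w [leRHS]mulrDr.
have ->: lyap_weight n L delta / 2 * ((alpha + delta) ^- 2 * 
   (alpha ^+ 2 * dotv w w + - (2 * alpha) * dotv e w +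
    (DD + 2 * dotv e q + - dotv q q))) =
    p * T / 2 * (alpha ^+ 2 * dotv w w + - (2 * alpha) * dotv e w +
    (DD + 2 * dotv e q + - dotv q q)).
  by rewrite /T -lyap_weight_rate //; ring.
(* The rate is also alpha^2 / (alpha + delta)^2, so the terms in |w|^2 on both sides agree
   exactly. *)
have -> : (1 - p * (alpha + delta) / (alpha + L + delta)) *
    (lyap_weight n L delta / 2 * dotv w w) = p * T / 2 * (alpha ^+ 2 * dotv w w).
  rewrite -rateE // /T -lyap_weight_rate //; field; rewrite A0 (gt_eqF a0) //=.
have p0 := pprob_gt0 (R := R) n_gt0.
(* The claim is the sum of the variance bound [h1], convexity at [y] with weight p tau_x in [h2],
   and the leftover square [h3]; [emE] cancels the inner products with [e]. *)
have h1 : 0 <= p * (T / 2) * (2 * L * (shifted x - shifted y -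
    (dotv e (x - xd) - dotv e (y - xd))) - DD).
  by rewrite mulr_ge0 ?subr_ge0 // mulr_ge0 ?divr_ge0 // ltW.
have TL1 : 0 <= 1 - T * L.
  have -> : 1 - T * L = T * (alpha + delta) by rewrite -TD; ring.
  by rewrite mulr_ge0 // ?ltW //; lra.
have h2 : 0 <= p * ((1 - T * L) * (dotv e (y - xd) - shifted y)).
  by rewrite mulr_ge0 ?(ltW p0) // mulr_ge0 // subr_ge0.
have h3 : 0 <= p * (T / 2) * dotv q q.
  by rewrite mulr_ge0 ?dotv_ge0 // mulr_ge0 ?divr_ge0 // ltW.
have -> : p * (alpha + delta) / (alpha + L + delta) = p * (1 - T * L).
  by rewrite -TD /T; ring.
move: (addr_ge0 (addr_ge0 h1 h2) h3); rewrite emE; lra.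
Qed.

End OneStep.

(** * Independent samples *)

Section IidSamples.
Context {R : realType} {A : finType}.
Hypothesis A_gt0 : (0 < #|A|)%N.

(** The mean over [M] independent uniform draws, taken one draw at a time to match the recursion of
    [xt_traj]. *)
Fixpoint mean_seq (M : nat) (F : seq A -> R) : R :=
  if M is M'.+1 then uexpect (fun a => mean_seq M' (fun s => F (a :: s)))
  else F [::].

Lemma ler_mean_seq M (F G : seq A -> R) :
  (forall s, size s = M -> F s <= G s) -> mean_seq M F <= mean_seq M G.
Proof.
elim: M F G => [|M IHM] F G FG /=; first exact: FG.
by apply: ler_uexpect => a; apply: IHM => s sM; apply: FG; rewrite /= sM.
Qed.

Lemma mean_seq_affine M (F : seq A -> R) (a b : R) :
  mean_seq M (fun s => a + b * F s) = a + b * mean_seq M F.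
Proof.
elim: M F => [//|M IHM] F /=.
rewrite -[in RHS](uexpect_const a A_gt0) -uexpectZ -uexpectD.
by apply: eq_uexpect => c; rewrite IHM.
Qed.

Definition resample {J : finType} (w : {ffun J -> A}) (j : J) (a : A) :=
  [ffun k => if k == j then a else w k].

Lemma uexpect_resample {J : finType} (j : J) (F : {ffun J -> A} -> R) :
  uexpect F = uexpect (fun a => uexpect (fun w => F (resample w j a))).
Proof.
(* Exchanging [a] with the entry [w j] is an involution. *)
pose h (x : A * {ffun J -> A}) := (x.2 j, resample x.2 j x.1).
have hK : involutive h.
  case=> a w; rewrite /h /= !ffunE eqxx; congr (_, _).
  by apply/ffunP => k; rewrite !ffunE; case: eqP => [->|].
have sumE : \sum_a \sum_w F (resample w j a) = #|A|%:R * \sum_w F w.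
  rewrite pair_big (reindex_inj (inv_inj hK)) /=.
  rewrite (eq_bigr (fun x : A * {ffun J -> A} => F x.2)) => [|x _]; last first.
    by congr F; apply/ffunP => k; rewrite !ffunE; case: eqP => [->|].
  by rewrite -(pair_big xpredT xpredT (fun _ w => F w)) /= sumr_const mulr_natl.
rewrite /uexpect -mulr_sumr sumE mulrCA mulKf //.
by rewrite pnatr_eq0 -lt0n.
Qed.

(** Distinct entries of a uniform function are independent: resampling the head entry leaves those
    of the tail untouched. *)
Lemma uexpect_map {J : finType} (s : seq J) (F : seq A -> R) : uniq s ->
  uexpect (fun w : {ffun J -> A} => F (map w s)) = mean_seq (size s) F.
Proof.
elim: s F => [|j s IHs] F /=.
  by move=> _; rewrite uexpect_const // card_ffun expn_gt0 A_gt0.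
case/andP=> js us; rewrite (uexpect_resample j); apply: eq_uexpect => a.
rewrite -(IHs (fun s => F (a :: s))) //; apply: eq_uexpect => w.
rewrite ffunE eqxx; congr (F (_ :: _)); apply/eq_in_map => k ks.
by rewrite ffunE; case: eqP => // kj; rewrite kj (negPf js) in ks.
Qed.

End IidSamples.

Section RowOfSamples.
Context {R : realType} {n l M : nat}.
Hypothesis n_gt0 : (0 < n)%N.

Lemma card_index_coin : (0 < #|{: 'I_n * 'I_n}|)%N.
Proof. by rewrite card_prod card_ord muln_gt0 n_gt0. Qed.

Lemma uexpect_samples (t : 'I_l.+1) (F : seq ('I_n * 'I_n) -> R) :
  uexpect (fun w : {ffun 'I_l.+1 * 'I_M -> 'I_n * 'I_n} => F (samples w t)) =
  mean_seq M F.
Proof.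
rewrite -[X in mean_seq X](size_enum_ord M) -(size_map (pair t)).
rewrite -(uexpect_map card_index_coin).
  by apply: eq_uexpect => w; rewrite -map_comp.
by rewrite map_inj_uniq ?enum_uniq // => i j [].
Qed.

End RowOfSamples.

(** * Growth of powers and least indices *)

Lemma bernoulli_le {R : realType} (x : R) (k : nat) : 0 <= x -> 1 + k%:R * x <= (1 + x) ^+ k.
Proof.
move=> x0; elim: k => [|k IHk]; first by rewrite expr0 mul0r addr0.
rewrite exprS -natr1; have := ler_wpM2l (addr_ge0 ler01 x0) IHk.
have : 0 <= k%:R * (x * x) by rewrite mulr_ge0 ?mulr_ge0.
lra.
Qed.

Lemma exists_expr_ge {R : realType} (b c : R) : 1 < b -> exists k : nat, c <= b ^+ k.
Proof.
move=> b1; have x0 : 0 < b - 1 by rewrite subr_gt0.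
have [k ck] : exists k : nat, c / (b - 1) <= k%:R.
  exists (Num.truncn `|c / (b - 1)|).+1; apply: le_trans (ler_norm _) _.
  by apply/ltW; rewrite truncnS_gt.
exists k; have := bernoulli_le _ k (ltW x0); rewrite (addrC 1 (b - 1)) subrK.
apply: le_trans; move: ck; rewrite ler_pdivrMr //; lra.
Qed.

(** [inner_break] and [first_outer] select a least index by [xget]; one index satisfying the test
    suffices to make the selection meaningful. *)
Lemma xget_min_nat (P : nat -> Prop) : (exists k, P k) ->
  let m := xget 0%N [set k | P k /\ forall j, (j < k)%N -> ~ P j] in
  P m /\ forall j, (j < m)%N -> ~ P j.
Proof.
move=> exP; have exb : exists k, `[< P k >] by case: exP => k ?; exists k; apply/asboolP.
apply: (@xgetPex _ 0%N [set k | P k /\ forall j, (j < k)%N -> ~ P j]).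
case: (ex_minnP exb) => m /asboolP Pm minm; exists m; split=> // j jm Pj.
by have := minm j (asboolT Pj); rewrite leqNgt jm.
Qed.

(** * Termination of one outer loop *)

Section InnerBreak.
Context {R : realType}.
Variables (n : nat) (L delta : R).
Hypotheses (n_gt0 : (0 < n)%N) (L_gt0 : 0 < L) (delta_gt0 : 0 < delta).

Lemma inner_breakP : let K := inner_break n L delta in
  ifc_break n L delta K /\ forall j, (j < K)%N -> ~ ifc_break n L delta j.
Proof.
have -> : inner_break n L delta = xget 0%N [set k | ifc_break n L delta k /\
    forall j, (j < k)%N -> ~ ifc_break n L delta j].
  congr (xget _ _); apply: eq_set => k; apply/propext.
  by split=> -[bk nb]; split=> // j jk; apply/negP; exact: nb.
apply: xget_min_nat.
apply: exists_expr_ge; rewrite ltrDl divr_gt0 //.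
exact: alpha_gt0.
Qed.

(** Square the break test at [K] and use 2 L <= C_IFC, valid since lambda is nonnegative. *)
Lemma inner_break_rate :
  (1 + delta / alpha n L delta) ^- 2 ^+ inner_break n L delta * (2 * L) <= 2 * delta.
Proof.
have [+ _] := inner_breakP; rewrite /ifc_break; set r := 1 + _; set K := inner_break _ _ _.
have a0 := alpha_gt0 _ _ n_gt0 L_gt0 delta_gt0.
have r0 : 0 < r by rewrite addr_gt0 // divr_gt0.
have lam0 := lyap_weight_ge0 _ _ n_gt0 L_gt0 delta_gt0.
have ld0 : 0 <= lyap_weight n L delta / delta by rewrite divr_ge0 // ltW.
have C0 : 2 * L <= C_IFC n L delta.
  rewrite C_IFC_E // ler_peMr //; last by lra.
  by rewrite mulr_ge0 // ltW.
have C1 : 0 <= C_IFC n L delta by apply: le_trans C0; rewrite mulr_ge0 // ltW.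
have d2 : 0 < 2 * delta by rewrite mulr_gt0.
rewrite -(@ler_pXn2r _ 2) ?nnegrE ?sqrtr_ge0 ?exprn_ge0 ?(ltW r0) //.
rewrite sqr_sqrtr ?divr_ge0 ?(ltW d2) // ler_pdivrMr // => CK.
rewrite exprVn mulrC ler_pdivrMr ?exprn_gt0 // exprAC.
by apply: le_trans C0 _; rewrite mulrC.
Qed.

End InnerBreak.

Section Trajectory.
Context {R : realType} {n d : nat}.
Variables (f : 'I_n -> 'rV[R]_d -> R) (g : 'I_n -> 'rV[R]_d -> 'rV[R]_d).
Variables (L delta : R) (x0 xd : 'rV[R]_d).
Hypotheses (n_gt0 : (0 < n)%N) (L_gt0 : 0 < L) (delta_gt0 : 0 < delta).
Hypotheses (fg : forall i, is_gradient (f i) (g i)).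
Hypotheses (f_cvx : forall i, convex_fn (f i)).
Hypotheses (g_lip : forall i, L_smooth_grad L (g i)).
Hypothesis (xd_stat : avgg g xd = - (delta *: (xd - x0))).
Local Notation rate := ((1 + delta / alpha n L delta) ^- 2).

Lemma size_xt_traj s z x : size (xt_traj g x0 L delta s z x) = (size s).+1.
Proof. by elim: s z x => [//|a s IHs] z x /=; rewrite IHs. Qed.

(** Induction on [k] for all states: the first draw is peeled off, the hypothesis is applied to the
    resulting state, and [lyapunov_step] averages over that draw. *)
Lemma mean_shifted_le k M z x : (k <= M)%N ->
  mean_seq M (fun s => shifted f g xd (nth x0 (xt_traj g x0 L delta s z x) k)) <=
  rate ^+ k * lyapunov f g L delta xd z x.
Proof.
have nthE s z' x' : nth x0 (xt_traj g x0 L delta s z' x') 0 = x' by case: s.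
have le_lyap z' x' : shifted f g xd x' <= lyapunov f g L delta xd z' x'.
  by rewrite lerDl mulr_ge0 ?dotv_ge0 // divr_ge0 // lyap_weight_ge0.
have A0 := card_index_coin n_gt0.
have rate0 : 0 <= rate by rewrite invr_ge0 sqr_ge0.
elim: k M z x => [|k IHk] M z x.
  move=> _; rewrite mul1r; apply: le_trans (le_lyap z x).
  have -> : shifted f g xd x =
      mean_seq M (fun s : seq ('I_n * 'I_n) => shifted f g xd x + 0 * 0).
    by rewrite mean_seq_affine // mul0r addr0.
  by apply: ler_mean_seq => s _; rewrite nthE mul0r addr0.
case: M => // M; rewrite ltnS => kM /=.
set y := y_of g x0 L delta z x.
pose V (a : 'I_n * 'I_n) := lyapunov f g L delta xd
  (z_next n L delta (G_of g x0 delta a.1 y x) z y) (if coin a then y else x).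
apply: (@le_trans _ _ (uexpect (fun a => rate ^+ k * V a))).
  by apply: ler_uexpect => a; exact: IHk.
rewrite uexpectZ [rate ^+ k.+1]exprSr -mulrA ler_wpM2l ?exprn_ge0 //.
exact: lyapunov_step.
Qed.

Variable Delta0 : R.
Hypothesis f_gap : forall x, avgf f x0 - avgf f x <= Delta0.

(** The tangent inequality at [xd] evaluated at [x0], with the gradient given by stationarity. *)
Let xd_dist : delta * dotv (xd - x0) (xd - x0) <= avgf f x0 - avgf f xd.
Proof.
have := avg_convex_ge _ _ _ L_gt0 fg f_cvx g_lip x0 xd.
by rewrite xd_stat -(opprB xd x0) dotvNl dotvNr opprK dotvZl; lra.
Qed.

(** The linear term of [shifted] contributes - delta |xd - x0|^2, which absorbs the distance term
    because lambda <= 2 delta. *)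
Lemma lyapunov_init : lyapunov f g L delta xd x0 x0 <= Delta0.
Proof.
rewrite /lyapunov /shifted -(opprB xd x0) xd_stat !(dotvNl, dotvNr, dotvZl, opprK).
have d0 := delta_gt0; have gap := f_gap xd.
have h : 0 <= (2 * delta - lyap_weight n L delta) * dotv (xd - x0) (xd - x0).
  by rewrite mulr_ge0 ?dotv_ge0 // subr_ge0 lyap_weight_le.
lra.
Qed.

Lemma enorm_grad_stationary : enorm (avgg g xd) <= Num.sqrt (2 * delta * Delta0).
Proof.
have D0 : 0 <= Delta0 by apply: le_trans (f_gap x0); rewrite subrr.
have d0 := delta_gt0; have gap := f_gap xd.
rewrite xd_stat /enorm ler_sqrt; last by rewrite !mulr_ge0 // ltW.
rewrite dotvNl dotvNr opprK dotvZl dotvZr.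
have := ler_wpM2l (ltW d0) (le_trans xd_dist gap).
have : 0 <= delta * Delta0 by rewrite mulr_ge0 // ltW.
lra.
Qed.

Variables (eps q : R).
Hypotheses (eps_gt0 : 0 < eps) (q_gt0 : 0 < q) (Delta0_gt0 : 0 < Delta0).
Hypothesis delta_le : delta <= eps ^+ 2 * q ^+ 2 / (8 * Delta0).

(** Markov's inequality in affine form: the indicator of termination dominates 1 minus a bound on
    the gradient norm at snapshot [K] divided by eps, and the mean of that bound is at most 2 s0. *)
Lemma terminates_prob M : (inner_break n L delta < M)%N ->
  1 - q <= mean_seq M (fun s => (loop_terminates g x0 L eps delta s)%:R).
Proof.
set K := inner_break n L delta => KM.
set s0 := Num.sqrt (2 * delta * Delta0).
have s_gt0 : 0 < s0 by rewrite sqrtr_gt0 !mulr_gt0.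
have s_sq : s0 ^+ 2 = 2 * delta * Delta0 by rewrite sqr_sqrtr // !mulr_ge0 // ltW.
(* Squared, this is 8 delta Delta0 <= eps^2 q^2: the origin of the 8 in the threshold on [delta]. *)
have s_le : 2 * s0 <= eps * q.
  rewrite -(@ler_pXn2r _ 2) ?nnegrE ?mulr_ge0 ?(ltW s_gt0) ?(ltW eps_gt0) ?(ltW q_gt0) //.
  rewrite exprMn s_sq exprMn.
  by move: delta_le; rewrite ler_pdivlMr ?mulr_gt0 //; lra.
pose h (s : seq ('I_n * 'I_n)) := shifted f g xd (nth x0 (xt_traj g x0 L delta s x0 x0) K).
have A0 := card_index_coin n_gt0.
have Eh : mean_seq M h * L <= s0 ^+ 2 / 2.
  have := mean_shifted_le K M x0 x0 (ltnW KM); rewrite -/h => le1.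
  have rate0 : 0 <= rate ^+ K by rewrite exprn_ge0 // invr_ge0 sqr_ge0.
  have := ler_wpM2l rate0 lyapunov_init => /(le_trans le1) le2.
  have := ler_wpM2r (ltW L_gt0) le2 => /le_trans; apply.
  have := ler_wpM2r (ltW Delta0_gt0) (inner_break_rate n L delta n_gt0 L_gt0 delta_gt0).
  rewrite s_sq -/K; clear le1 le2 rate0; move: (rate ^+ K) (mean_seq M h) => c m; lra.
have se0 : 0 < s0 * eps by rewrite mulr_gt0.
(* AM-GM: [|grad h| <= |grad h|^2 / (2 s0) + s0 / 2 <= L h / s0 + s0 / 2]. *)
pose a := 1 - 3 / 2 * (s0 / eps); pose b := - (L / (s0 * eps)).
apply: (@le_trans _ _ (mean_seq M (fun s => a + b * h s))).
  rewrite mean_seq_affine // /a /b.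
  have -> : 1 - 3 / 2 * (s0 / eps) + - (L / (s0 * eps)) * mean_seq M h =
      1 - (3 / 2 * s0 ^+ 2 + mean_seq M h * L) / (s0 * eps).
    by field; rewrite !gt_eqF.
  rewrite lerD2l lerN2 ler_pdivrMr //.
  have := ler_wpM2l (ltW s_gt0) s_le; lra.
apply: ler_mean_seq => s sM.
have eps0 := eps_gt0; have L0 := L_gt0.
pose x := nth x0 (xt_traj g x0 L delta s x0 x0) K.
have hsE : h s = shifted f g xd x by [].
have normx : enorm (avgg g x) <= 3 / 2 * s0 + L * h s / s0.
  have -> : avgg g x = avgg g x - avgg g xd + avgg g xd by rewrite subrK.
  apply: le_trans (ler_enormD _ _) _.
  have := enorm_grad_stationary; rewrite -/s0 => le_xd.
  have := enorm_grad_shifted f g L xd n_gt0 L_gt0 fg f_cvx g_lip x.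
  rewrite -hsE; set e := enorm (avgg g x - _) => le_e.
  suff : e <= s0 / 2 + L * h s / s0 by lra.
  rewrite -(@ler_pM2r _ s0) // mulrDl divfK ?gt_eqF //.
  have := sqr_ge0 (e - s0); lra.
have hE : a + b * h s = 1 - (3 / 2 * s0 + L * h s / s0) / eps.
  by rewrite /a /b; field; rewrite !gt_eqF.
rewrite hE; case: (boolP (loop_terminates _ _ _ _ _ _)) => [_|].
  rewrite gerBl divr_ge0 ?(ltW eps_gt0) //; apply: le_trans normx; exact: enorm_ge0.
move/hasPn/(_ x) => nostop.
have : ~~ stop_test g eps x.
  (* [loop_xts] keeps [K.+1] snapshots, so index [K] is the last one tested. *)
  apply: nostop; rewrite /loop_xts -/K /x.
  have Ks : (K < size (xt_traj g x0 L delta s x0 x0))%N.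
    by rewrite size_xt_traj sM ltnS ltnW.
  rewrite -(nth_take x0 (ltnSn K)); apply: mem_nth.
  by rewrite size_take; case: ifP.
rewrite /stop_test -ltNge => lt_eps.
by rewrite subr_le0 ler_pdivlMr // mul1r ltW // (lt_le_trans lt_eps).
Qed.

End Trajectory.

(** * Oracle complexity *)

Section Cost.
Context {R : realType} {n d : nat}.
Variables (g : 'I_n -> 'rV[R]_d -> 'rV[R]_d) (L : R) (x0 : 'rV[R]_d).
Hypothesis n_gt0 : (0 < n)%N.
Local Notation p := (pprob R n).

Lemma mean_seq_coin M j (v : bool -> R) : (j < M)%N ->
  mean_seq M (fun s : seq ('I_n * 'I_n) => v (nth false (map (@coin n) s) j)) =
  p * v true + (1 - p) * v false.
Proof.
have A0 := card_index_coin n_gt0.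
elim: M j => [//|M IHM] [|j] /= jM; last first.
  by rewrite IHM // uexpect_const.
have -> : uexpect (fun a : 'I_n * 'I_n =>
      mean_seq M (fun _ : seq ('I_n * 'I_n) => v (coin a))) =
    uexpect (fun a : 'I_n * 'I_n => 0 + v (coin a)).
  apply: eq_uexpect => a.
  have := @mean_seq_affine R _ A0 M (fun=> 0) (v (coin a)) 0.
  by rewrite mulr0 mul0r addr0 add0r.
rewrite (uexpect_index_coin n_gt0 (fun=> 0) v).
by rewrite big1 // mulr0 add0r.
Qed.

(** Early termination only saves cost, so every loop is charged its full [K.+1] iterations: n + 2
    for the first and 3 on average for each later one. *)
Lemma uexpect_run_cost_le (eps beta : R) (l M : nat) :
  (forall t : 'I_l.+1, inner_break n L (delta_t L beta t) < M)%N ->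
  uexpect (fun w : {ffun 'I_l.+1 * 'I_M -> 'I_n * 'I_n} =>
    (run_cost g x0 L eps beta w)%:R) <=
  \sum_(t < l.+1) (n%:R + 2 + 3 * (inner_break n L (delta_t L beta t))%:R) :> R.
Proof.
move=> KM; pose K (t : 'I_l.+1) := inner_break n L (delta_t L beta t).
pose c (w : {ffun 'I_l.+1 * 'I_M -> 'I_n * 'I_n}) t (k : nat) : R :=
  2 + (if (k == 0)%N || nth false (map (@coin n) (samples w t)) k.-1 then n%:R else 0).
apply: (@le_trans _ _ (uexpect (fun w => \sum_(t < l.+1) \sum_(k < (K t).+1) c w t k))).
  apply: ler_uexpect => w; rewrite /run_cost natr_sum; apply: ler_sum => t _.
  have c0 k : 0 <= c w t k by rewrite addr_ge0 //; case: ifP.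
  case: ifP => _; last by apply: sumr_ge0.
  rewrite /loop_cost natr_sum.
  have iters_le : (loop_iters g x0 L eps (delta_t L beta t) (samples w t) <= (K t).+1)%N.
    exact: geq_minr.
  rewrite (big_ord_widen _ (fun k => (2 + (if (k == 0)%N || nth false
    (map (@coin n) (samples w t)) k.-1 then n else 0))%:R) iters_le) big_mkcond /=.
  apply: ler_sum => k _; case: ifP => // _.
  by rewrite /c natrD; case: ifP.
rewrite uexpect_sum; apply: ler_sum => t _; rewrite uexpect_sum big_ord_recl /=.
have c_first : uexpect (fun w => c w t 0%N) = n%:R + 2.
  rewrite /c /= uexpect_const; first by rewrite addrC.
  by rewrite card_ffun expn_gt0 card_index_coin.
(* Iteration k + 1 pays for a full gradient when coin k succeeded, hence 2 + n p = 3. *)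
have c_next (k : 'I_(K t)) : uexpect (fun w => c w t (bump 0 k)) = 3.
  pose v b : R := 2 + (if b then n%:R else 0).
  have -> : (fun w => c w t (bump 0 k)) =
      fun w => v (nth false (map (@coin n) (samples w t)) k) by [].
  rewrite (uexpect_samples n_gt0 t (fun s => v (nth false (map (@coin n) s) k))).
  rewrite mean_seq_coin; last by apply: ltn_trans (ltn_ord k) (KM t).
  have := mulr_natp (R := R) n_gt0; rewrite /v /=; lra.
rewrite c_first (eq_bigr _ (fun k _ => c_next k)) sumr_const card_ord mulr_natr.
exact: lexx.
Qed.

End Cost.

(** The iteration before the break fails the test, which bounds a power of 1 + delta / alpha; taking
    logarithms and using [alpha_le] bounds its index. *)
Lemma inner_break_le {R : realType} (n : nat) (L delta : R) :
  (0 < n)%N -> 0 < delta -> delta <= L ->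
  (inner_break n L delta)%:R <=
  1 + (4 * n%:R + 2 * Num.sqrt (n%:R * (L / delta)) + 1) * ln (3 * (L / delta)).
Proof.
move=> n0 d0 dL; have L0 : 0 < L by apply: lt_le_trans dL.
have k1 : 1 <= L / delta by rewrite ler_pdivlMr ?mul1r.
have [a0 aeq] := alpha_spec _ _ n0 L0 d0.
have := alpha_le _ _ n0 L0 d0 _ a0 aeq; rewrite /alpha_bound.
have := lyap_weight_le _ _ n0 L0 d0; have := lyap_weight_ge0 _ _ n0 L0 d0.
have := @inner_breakP R n L delta n0 L0 d0; rewrite /ifc_break C_IFC_E //.
set kappa := L / delta in k1 *; set lm := lyap_weight _ _ _; set a := alpha _ _ _ in a0 *.
set s := Num.sqrt (n%:R * kappa).
have s0 : 0 <= s := sqrtr_ge0 _.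
have ln0 : 0 <= ln (3 * kappa) by rewrite ln_ge0 //; lra.
have n0' : 0 <= n%:R :> R by [].
move: (inner_break _ _ _) => [|k] [_ nbrk] lm0 lm_le a_le.
  by rewrite addr_ge0 // mulr_ge0 //; lra.
have {nbrk} := nbrk k (ltnSn k).
set r := 1 + delta / a; move/negP; rewrite -ltNge => rk.
have r1 : 1 < r by rewrite ltrDl divr_gt0.
(* The squared threshold is kappa (1 + lambda / delta) <= 3 kappa, and 3 kappa <= (3 kappa)^2 since
   kappa >= 1. *)
have rk3 : r ^+ k <= 3 * kappa.
  apply: (le_trans (ltW rk)); rewrite -(@ler_pXn2r _ 2) ?nnegrE ?sqrtr_ge0 //; last lra.
  have -> : 2 * L * (1 + lm / delta) / (2 * delta) = kappa * (1 + lm / delta).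
    by rewrite /kappa; field; rewrite gt_eqF.
  have le2 : lm / delta <= 2 by rewrite ler_pdivrMr.
  have ge0 : 0 <= lm / delta by rewrite divr_ge0 // ltW.
  have k0 : 0 <= kappa by lra.
  rewrite sqr_sqrtr; last by rewrite mulr_ge0 //; lra.
  apply: (@le_trans _ _ (kappa * 3)); first by rewrite ler_wpM2l //; lra.
  have := ler_wpM2l k0 k1; lra.
have ln_rk : k%:R * ln r <= ln (3 * kappa).
  rewrite mulr_natl -lnXn ?(lt_trans ltr01) // ler_ln ?posrE //; last lra.
  by rewrite exprn_gt0 // (lt_trans ltr01).
(* Apply ln (1 + x) <= x to 1 / r = 1 - 1 / (a / delta + 1). *)
have ln_r : (a / delta + 1)^-1 <= ln r.
  have ad : a + delta != 0 by rewrite gt_eqF // addr_gt0.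
  have rV : r^-1 = 1 + - (a / delta + 1)^-1.
    by rewrite /r; field; rewrite ad !gt_eqF.
  rewrite -[leRHS]opprK -lnV ?posrE ?(lt_trans ltr01) // rV lerNr.
  apply: le_ln1Dx; rewrite ltrN2 invf_lt1 ?ltrDr ?divr_gt0 //.
  by rewrite addr_gt0 // divr_gt0.
have u0 : 0 < a / delta + 1 by rewrite addr_gt0 // divr_gt0.
have k_le : k%:R <= (a / delta + 1) * ln (3 * kappa).
  rewrite -ler_pdivrMl // mulrC; apply: le_trans ln_rk.
  by rewrite ler_wpM2l.
rewrite -natr1 addrC lerD2l; apply: le_trans k_le _; rewrite ler_wpM2r // lerD2r.
by rewrite ler_pdivrMr // mulrC.
Qed.

Lemma geometric_sum_le {R : realType} (r : R) (l : nat) : 1 < r ->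
  \sum_(t < l.+1) r ^+ t <= r ^+ l * (r / (r - 1)).
Proof.
move=> r1; have r0 : 0 < r - 1 by rewrite subr_gt0.
rewrite mulrA ler_pdivlMr // mulrC -subrX1 -exprSr.
by rewrite gerBl.
Qed.

Section FirstOuter.
Context {R : realType}.
Variables (L beta dstar : R).
Hypotheses (L_gt0 : 0 < L) (beta_gt1 : 1 < beta) (dstar_gt0 : 0 < dstar).

Let beta_gt0 : 0 < beta.
Proof. exact: lt_trans ltr01 beta_gt1. Qed.

Lemma delta_t_le t : (delta_t L beta t <= dstar) = (L / dstar <= beta ^+ t).
Proof. by rewrite /delta_t !ler_pdivrMr ?exprn_gt0 // mulrC. Qed.

Lemma first_outerP : let l := first_outer L beta dstar in
  L / dstar <= beta ^+ l /\ forall j, (j < l)%N -> beta ^+ j < L / dstar.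
Proof.
have [] := @xget_min_nat (fun t => delta_t L beta t <= dstar).
  have [k Lk] := exists_expr_ge beta (L / dstar) beta_gt1.
  by exists k; rewrite delta_t_le.
rewrite -/(first_outer L beta dstar) delta_t_le => le_l lt_l; split=> // j /lt_l.
by rewrite delta_t_le => /negP; rewrite -ltNge.
Qed.

End FirstOuter.

(** The numerical core, with 8 X^2 standing for L / dstar: the number of loops and each logarithm
    are O(ln (2 + X)), and the square roots sum geometrically to O(X). *)
Lemma complexity_sum {R : realType} (beta : R) : 1 < beta ->
  exists C : R, 0 < C /\ forall (n l : nat) (X : R) (K : nat -> R),
    (0 < n)%N -> 0 < X -> 1 <= 8 * X ^+ 2 ->
    (forall j, (j < l)%N -> beta ^+ j < 8 * X ^+ 2) ->
    (forall t, (t <= l)%N -> K t <= 1 +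
      (4 * n%:R + 2 * Num.sqrt (n%:R * beta ^+ t) + 1) * ln (3 * beta ^+ t)) ->
    \sum_(t < l.+1) (n%:R + 2 + 3 * K t) <=
      C * ((n%:R * ln (2 + X) + Num.sqrt n%:R * X) * ln (2 + X)).
Proof.
move=> b1; have b0 : 0 < beta by apply: lt_trans b1.
have ln2 : 0 < ln (2 : R) by rewrite ln_gt0 // ltr1n.
have lnb : 0 < ln beta by rewrite ln_gt0.
have ln24 : 0 < ln (24 * beta) by rewrite ln_gt0 //; lra.
pose r := Num.sqrt beta.
have r1 : 1 < r by rewrite -[ltLHS]sqrtr1 ltr_sqrt.
have r0 : 0 < r by apply: lt_trans r1.
(* [c1] bounds the logarithm of a loop and [c2] the number of loops, in units of ln (2 + X); [c3]
   bounds the geometric sum in units of X. *)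
pose c1 := ln (24 * beta) / ln 2 + 2.
pose c2 := 2 / ln 2 + 5 / ln beta.
pose c3 := Num.sqrt (8 * beta) * (r / (r - 1)).
have c1_gt0 : 0 < c1 by rewrite addr_gt0 // divr_gt0.
have c2_gt0 : 0 < c2 by rewrite addr_gt0 // divr_gt0.
have c3_gt0 : 0 < c3.
  by rewrite mulr_gt0 ?sqrtr_gt0 ?mulr_gt0 // invr_gt0 subr_gt0.
pose c4 := 6 / ln 2 + 15 * c1.
have c4_gt0 : 0 < c4 by apply: addr_gt0; [exact: divr_gt0|exact: mulr_gt0].
exists (c2 * c4 + 6 * c1 * c3); split.
  by apply: addr_gt0; apply: mulr_gt0 => //; exact: mulr_gt0.
move=> n l X K n0 X0 X8 bl Kle.
set LX := ln (2 + X); set sn := Num.sqrt n%:R.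
(* The shift by 2 keeps [LX] away from 0, so additive constants become multiples of [LX]. *)
have LX2 : ln 2 <= LX by rewrite ler_ln ?posrE //; lra.
have LX0 : 0 < LX by apply: lt_le_trans LX2.
have lnX : ln X <= LX by rewrite ler_ln ?posrE //; lra.
have sn0 : 0 <= sn := sqrtr_ge0 _.
have n1 : 1 <= n%:R :> R by rewrite ler1n.
have X2 : 0 < X ^+ 2 by rewrite exprn_gt0.
have ln_X2 : ln (X ^+ 2) = 2 * ln X by rewrite lnXn // mulr_natl.
(* The hypothesis at l - 1 costs one more factor [beta]; for l = 0, [X8] replaces it. *)
have bl_le : beta ^+ l <= 8 * beta * X ^+ 2.
  case: l bl {Kle} => [|l] bl.
    by apply: (le_trans X8); rewrite mulrAC ler_peMr // ltW // mulr_gt0.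
  by rewrite exprS mulrAC mulrC ler_pM2r // ltW // bl.
(* For l >= 1, (l - 1) ln beta <= 3 ln 2 + 2 ln X <= 5 LX; the remaining 2 is at most 2 / ln 2 *
   LX. *)
have l_le : l.+1%:R <= c2 * LX.
  have ge2 : 2 <= 2 / ln 2 * LX by rewrite mulrAC ler_pdivlMr // ler_pM2l.
  case: l bl {Kle bl_le} => [|l] bl.
    apply: (@le_trans _ _ 2); first by lra.
    apply: (le_trans ge2); rewrite /c2 [leRHS]mulrDl lerDl mulr_ge0 ?divr_ge0 // ltW //.
  have ln8 : ln 8 = 3 * ln 2 :> R.
    by rewrite (_ : 8 = 2 ^+ 3) ?lnXn ?mulr_natl //; ring.
  have : ln (beta ^+ l) <= ln (8 * X ^+ 2).
    by rewrite ler_ln ?posrE ?exprn_gt0 ?mulr_gt0 // ltW // bl.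
  rewrite lnXn // lnM ?posrE // ln8 ln_X2 -mulr_natl => le5.
  have le5' : l%:R <= 5 / ln beta * LX by rewrite mulrAC ler_pdivlMr //; lra.
  by rewrite -!natr1 /c2; lra.
have lnt t : (t <= l)%N -> ln (3 * beta ^+ t) <= c1 * LX.
  move=> tl; apply: (@le_trans _ _ (ln (24 * beta * X ^+ 2))).
    rewrite ler_ln ?posrE ?mulr_gt0 ?exprn_gt0 //.
    have := ler_weXn2l (ltW b1) tl; lra.
  rewrite lnM ?posrE ?mulr_gt0 // ln_X2 /c1.
  have : ln (24 * beta) <= ln (24 * beta) / ln 2 * LX.
    by rewrite mulrAC ler_pdivlMr // ler_pM2l.
  lra.
have lnt0 t : 0 <= ln (3 * beta ^+ t).
  by rewrite ln_ge0 //; have := exprn_ege1 t (ltW b1); lra.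
have sqrt_pow t : Num.sqrt (beta ^+ t) = r ^+ t.
  by elim: t => [|t IHt]; rewrite ?expr0 ?sqrtr1 // !exprS sqrtrM ?(ltW b0) // IHt.
(* As n >= 1, n + 5 <= 6 n and 4 n + 1 <= 5 n. *)
have term t : (t <= l)%N -> n%:R + 2 + 3 * K t <=
    (6 * n%:R + 15 * n%:R * (c1 * LX)) + 6 * (c1 * LX) * sn * r ^+ t.
  move=> tl; have := Kle t tl; rewrite sqrtrM ?ler0n // sqrt_pow -/sn.
  have rt0 : 0 <= r ^+ t by rewrite exprn_ge0 // ltW.
  have := mulr_ge0 sn0 rt0; set m := sn * r ^+ t => m0.
  have -> : 6 * (c1 * LX) * sn * r ^+ t = 6 * (c1 * LX) * m by rewrite -mulrA.
  have f0 : 0 <= 5 * n%:R + 2 * m :> R by rewrite addr_ge0 // mulr_ge0.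
  have := ler_wpM2l f0 (lnt t tl).
  have : (4 * n%:R + 2 * m + 1) * ln (3 * beta ^+ t) <=
      (5 * n%:R + 2 * m) * ln (3 * beta ^+ t).
    by apply: ler_wpM2r; [exact: lnt0|lra].
  move: (ln _) (m) (K t) (c1 * LX) => u m' k v; lra.
apply: le_trans (ler_sum _ (fun (t : 'I_l.+1) _ => term t (ltn_ord t))) _.
rewrite big_split /= sumr_const card_ord -mulr_sumr -[X in X + _]mulr_natl.
have geo : \sum_(t < l.+1) r ^+ t <= c3 * X.
  apply: le_trans (geometric_sum_le _ l r1) _.
  have q0 : 0 <= r / (r - 1) by rewrite divr_ge0 ?subr_ge0 // ltW.
  rewrite /c3 mulrAC ler_wpM2r // -sqrt_pow.
  have -> : Num.sqrt (8 * beta) * X = Num.sqrt (8 * beta * X ^+ 2).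
    by rewrite [RHS]sqrtrM ?mulr_ge0 ?(ltW b0) // sqrtr_sqr gtr0_norm.
  by rewrite ler_sqrt // !mulr_ge0 // ltW.
have geo2 := ler_wpM2l (mulr_ge0 (mulr_ge0 (ler0n _ 6) (ltW (mulr_gt0 c1_gt0 LX0))) sn0) geo.
have nle : 6 * n%:R + 15 * n%:R * (c1 * LX) <= c4 * (n%:R * LX).
  have : n%:R <= 1 / ln 2 * (n%:R * LX).
    by rewrite mulrAC ler_pdivlMr // mul1r ler_pM2l // ltr0n.
  rewrite /c4; lra.
have f0 : 0 <= c4 * (n%:R * LX).
  by rewrite !mulr_ge0 // ltW.
have first_le := le_trans (ler_wpM2l (ler0n _ l.+1) nle) (ler_wpM2r f0 l_le).
apply: le_trans (lerD first_le geo2) _.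
have C1 : 0 <= c2 * c4 * (sn * X * LX) by rewrite !mulr_ge0 // ltW.
clearbody c3; have C2 : 0 <= 6 * c1 * c3 * (n%:R * LX * LX).
  by rewrite !mulr_ge0 // ltW.
lra.
Qed.

(** * Probabilities as expectations, and assembly of the two claims *)

Lemma uprobE {R : realType} {T : finType} (A : pred T) :
  uprob R A = uexpect (fun w => (A w)%:R).
Proof.
rewrite /uprob /uexpect mulrC -sum1_card natr_sum [in RHS](bigID A) /=.
rewrite [X in _ = _ * (_ + X)]big1 ?addr0 => [|w /negPf -> //].
by congr (_ * _); apply: eq_big => // w Aw; rewrite [A w]Aw.
Qed.

Theorem theorem7 (R : realType) (beta : R) (hbeta : 1 < beta) :
  exists C : R, 0 < C /\
  forall (n d : nat) (f : 'I_n -> 'rV[R]_d -> R) (g : 'I_n -> 'rV[R]_d -> 'rV[R]_d)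
         (L : R) (xs x0 : 'rV[R]_d) (Delta0 eps q : R),
    (0 < n)%N -> 0 < L ->
    (forall i, is_gradient (f i) (g i)) ->
    (forall i, convex_fn (f i)) ->
    (forall i, L_smooth_grad L (g i)) ->
    is_minimizer (avgf f) xs ->
    0 < Delta0 -> avgf f x0 - avgf f xs <= Delta0 ->
    0 < eps -> 0 < q < 1 ->
    let dstar := eps ^+ 2 * q ^+ 2 / (8 * Delta0) in
    dstar <= L ->
    let l := first_outer L beta dstar in
    let M := samples_len n L beta l in
    let X := Num.sqrt (L * Delta0) / (eps * q) in
    (* (i) outer iteration l terminates with probability >= 1 - q *)
    1 - q <= @uprob R _ (fun w : {ffun 'I_l.+1 * 'I_M -> 'I_n * 'I_n} =>
                      loop_terminates g x0 L eps (delta_t L beta l) (samples w ord_max))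
    /\
    (* (ii) expected oracle complexity of the l+1 outer loops *)
    uexpect (fun w : {ffun 'I_l.+1 * 'I_M -> 'I_n * 'I_n} =>
               (run_cost g x0 L eps beta w)%:R)
      <= C * ((n%:R * ln (2 + X) + Num.sqrt (n%:R) * X) * ln (2 + X)).
Proof.
have [C [C0 C_le]] := complexity_sum beta hbeta.
exists C; split=> // n d f g L xs x0 Delta0 eps q n0 L0 fg f_cvx g_lip xs_min.
move=> D0 gap eps0 /andP[q0 _] dstar dstarL l M X.
have eq0 : 0 < eps * q by rewrite mulr_gt0.
have dstar0 : 0 < dstar by rewrite /dstar divr_gt0 ?mulr_gt0 ?exprn_gt0.
have b0 : 0 < beta := lt_trans ltr01 hbeta.
have delta0 t : 0 < delta_t L beta t by rewrite divr_gt0 // exprn_gt0.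
have deltaL t : delta_t L beta t <= L.
  by rewrite ler_pdivrMr ?exprn_gt0 // ler_peMr ?exprn_ege1 // ltW.
have [] := first_outerP L beta dstar hbeta dstar0; rewrite -/l => le_l lt_l.
have X0 : 0 < X by rewrite divr_gt0 // sqrtr_gt0 mulr_gt0.
have ratioE : L / dstar = 8 * X ^+ 2.
  rewrite /X expr_div_n sqr_sqrtr ?mulr_ge0 ?(ltW L0) ?(ltW D0) // /dstar.
  by field; rewrite !gt_eqF.
(* Each row holds at least one more sample than any break index, so no trajectory is cut short. *)
have KM (t : 'I_l.+1) : (inner_break n L (delta_t L beta t) < M)%N.
  rewrite /M /samples_len.
  exact: (leq_bigmax (F := fun t : 'I_l.+1 => (inner_break n L (delta_t L beta t)).+1)).
split.
  (* The minimum value of f supplies the lower bound that makes the regularized problem coercive. *)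
  have [xd xd_stat] := exists_regularized_stationary (avgf f) (avgg g) L
    (delta_t L beta l) (avgf f xs) x0 L0 (delta0 l) (avg_continuous _ _ fg) xs_min
    (avg_smooth_le _ _ _ n0 fg g_lip).
  rewrite uprobE (uexpect_samples n0 ord_max (fun s =>
    (loop_terminates g x0 L eps (delta_t L beta l) s)%:R)).
  apply: (terminates_prob f g L _ x0 xd n0 L0 (delta0 l) fg f_cvx g_lip xd_stat Delta0) => //.
  - by move=> x; apply: le_trans gap; rewrite lerD2l lerN2.
  - by rewrite delta_t_le.
  - exact: KM ord_max.
apply: le_trans (uexpect_run_cost_le g L x0 n0 eps beta l M KM) _.
pose K t : R := (inner_break n L (delta_t L beta t))%:R.
apply: (C_le n l X K) => //; rewrite -?ratioE.
- by rewrite ler_pdivlMr // mul1r.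
- by [].
move=> t _; have := inner_break_le n L _ n0 (delta0 t) (deltaL t).
have -> : L / delta_t L beta t = beta ^+ t.
  by rewrite /delta_t; field; rewrite expf_neq0 ?gt_eqF.
by [].
Qed.
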